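(* Let $p$ be an odd prime, let $n\ge 3$ be an odd integer, and let $f:\mathbb{F}_p^n\to\mathbb{F}_p$ be a non-weakly regular bent function belonging to $\mathcal{DBF}$. If $p\equiv1\pmod4$, assume that $B_-(f)$ and $B_-(f^* )$ are both non-degenerate $r$-dimensional subspaces over $\mathbb{F}_p$; if $p\equiv3\pmod 4$, assume that $B_+(f)$ and $B_-(f^* )$ are both non-degenerate $r$-dimensional subspaces over $\mathbb{F}_p$. (i) If $r=\frac{n+1}2$ and $p\equiv1\pmod4$, then $$U_{22}=\Big\{\{0\},\ c_0(f),\ \bigcup_{i\in SQ}c_i(f),\ \bigcup_{i\in NSQ}c_i(f),\ d_0(f)\setminus\{0\},\ \bigcup_{i\in NSQ}d_i(f)\Big\}$$ is a partition of $\mathbb{F}_p^n$ and induces a $5$-class symmetric association scheme. (ii) If $r=\frac{n+1}2$ and $p\equiv3\pmod4$, then $$U_{23}=\Big\{\{0\},\ c_0(f),\ \bigcup_{i\in SQ}c_i(f),\ \bigcup_{i\in NSQ}c_i(f),\ d_0(f)\setminus\{0\},\ \bigcup_{i\in SQ}d_i(f)\Big\}$$ is a partition of $\mathbb{F}_p^n$ and induces a $5$-class symmetric association scheme. (iii) If $\frac{n+1}2<r\le n-1$ and $p\equiv1\pmod4$, then $$U_{24}=\Big\{\{0\},\ c_0(f),\ \bigcup_{i\in SQ}c_i(f),\ \bigcup_{i\in NSQ}c_i(f),\ B_-(f)^\bot\setminus\{0\},\ d_0(f)\setminus B_-(f)^\bot,\ \bigcup_{i\in SQ}d_i(f),\ \bigcup_{i\in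 NSQ}d_i(f)\Big\}$$ is a partition of $\mathbb{F}_p^n$ and induces a $7$-class symmetric association scheme. (iv) If $\frac{n+1}2<r\le n-1$ and $p\equiv3\pmod4$, then $$U_{25}=\Big\{\{0\},\ c_0(f),\ \bigcup_{i\in SQ}c_i(f),\ \bigcup_{i\in NSQ}c_i(f),\ B_+(f)^\bot\setminus\{0\},\ d_0(f)\setminus B_+(f)^\bot,\ \bigcup_{i\in SQ}d_i(f),\ \bigcup_{i\in NSQ}d_i(f)\Big\}$$ is a partition of $\mathbb{F}_p^n$ and induces a $7$-class symmetric association scheme.
   Context: Let $p$ be an odd prime, $n$ a positive integer, $x\cdot y$ the ordinary inner product on $\mathbb{F}_p^n$, and $\xi_p=e^{2\pi\sqrt{-1}/p}$. $SQ$ and $NSQ$ denote the sets of squares and of nonsquares in $\mathbb{F}_p^*$. Bent functions. For $f:\mathbb{F}_p^n\to\mathbb{F}_p$ the Walsh transform is $\mathcal{W}_f(\alpha)=\sum_{x\in\mathbb{F}_p^n}\xi_p^{f(x)-\alpha\cdot x}$, $\alpha\in\mathbb{F}_p^n$; $f$ is bent if $|\mathcal{W}_f(\alpha)|=p^{n/2}$ for all $\alpha$. Put $\mu=1$ if $p^n\equiv1\pmod 4$ and $\mu=\sqrt{-1}$ if $p^n\equiv3\pmod4$. For a bent $f$ it is known that for every $\alpha$, $\mathcal{W}_f(\alpha)\in\{\mu p^{n/2}\xi_p^{f^*(\alpha)},-\mu p^{n/2}\xi_p^{f^*(\alpha)}\}$ for a (unique) function $f^*:\mathbb{F}_p^n\to\mathbb{F}_p$,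 called the dual of $f$. A bent $f$ is weakly regular if there is $\lambda\in\{\pm1,\pm\sqrt{-1}\}$ independent of $\alpha$ with $\mathcal{W}_f(\alpha)=\lambda p^{n/2}\xi_p^{f^*(\alpha)}$ for all $\alpha$; otherwise it is non-weakly regular. A bent $f$ is dual-bent if $f^*$ is also bent. For a bent function $f$: $B_+(f)=\{\alpha:\mathcal{W}_f(\alpha)=\mu p^{n/2}\xi_p^{f^*(\alpha)}\}$ and $B_-(f)=\{\alpha:\mathcal{W}_f(\alpha)=-\mu p^{n/2}\xi_p^{f^*(\alpha)}\}$. For $f$ dual-bent, $B_\pm(f^* )$ are defined by the same formulas applied to the bent function $f^*$. For dual-bent $f$ and $j\in\mathbb{F}_p$: $c_j(f)=\{x\in B_+(f^* ):f(x)=j\}$, $d_j(f)=\{x\in B_-(f^* ):f(x)=j\}$. $\mathcal{DBF}$ is the set of dual-bent functions $f:\mathbb{F}_p^n\to\mathbb{F}_p$ such that $f(0)=0$ and there is a positive integer $h$ with $\gcd(h-1,p-1)=1$ and $f(ax)=a^hf(x)$ for all $a\in\mathbb{F}_p^*$, $x\in\mathbb{F}_p^n$. For a subspace $V$ of $\mathbb{F}_p^n$, $V^\bot$ is its orthogonal complement with respect to $\cdot$; $V$ is non-degenerate if $\{x\in V:x\cdot y=0\ \text{for all } y\in V\}=\{0\}$. Association schemes. A $d$-class association scheme on a nonempty finite set $X$ is a partition of $X\times X$ into relations $R_0,\dots,R_d$ such that $R_0=\{(x,x):x\in X\}$; for each $j$ the transpose $R_j^T$ equals some $R_{j'}$;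 and for all $u,v,w$ and $(x,y)\in R_w$ the number $|\{z\in X:(x,z)\in R_u,(z,y)\in R_v\}|$ depends only on $u,v,w$. It is symmetric if $R_j^T=R_j$ for all $j$. A partition $\{U_i\}_{i=0}^d$ of $\mathbb{F}_p^n$ (into nonempty sets) with $U_0=\{0\}$ induces a $d$-class symmetric association scheme if the relations $R_i=\{(\alpha,\beta):\alpha-\beta\in U_i\}$, $0\le i\le d$, form a symmetric association scheme on $\mathbb{F}_p^n$. *)

(* Defs.v *)
From HB Require Import structures.
From mathcomp Require Import all_boot all_order all_algebra.
From mathcomp Require Import complex reals trigo.

Set Implicit Arguments.
Unset Strict Implicit.
Unset Printing Implicit Defensive.

Import Order.TTheory GRing.Theory Num.Theory.
Local Open Scope ring_scope.
Local Open Scope complex_scope.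

Section Geometry.
Variables p n : nat.
Implicit Types (x y : 'rV['F_p]_n) (S : {set 'rV['F_p]_n}).

Definition dot x y : 'F_p := \sum_(i < n) x 0 i * y 0 i.

Definition is_subspace_of_dim r S :=
  exists V : {vspace 'rV['F_p]_n}, S = [set x | x \in V] /\ \dim V = r.

Definition dot_nondegenerate S :=
  [set x in S | [forall y in S, dot x y == 0]] = [set 0].

Definition dot_perp S : {set 'rV['F_p]_n} :=
  [set x | [forall y in S, dot x y == 0]].

End Geometry.

Definition SQ (p : nat) : {set 'F_p} :=
  [set i | (i != 0) && [exists b : 'F_p, i == b ^+ 2]].

Definition NSQ (p : nat) : {set 'F_p} :=
  [set i | (i != 0) && ~~ [exists b : 'F_p, i == b ^+ 2]].

Section Bent.
Variables (R : realType) (p n : nat).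
Implicit Types (f : 'rV['F_p]_n -> 'F_p) (alpha : 'rV['F_p]_n).

Definition xi : R[i] := cos (2 * pi / p%:R) +i* sin (2 * pi / p%:R).

Definition xi_pow (j : 'F_p) : R[i] := xi ^+ (j : nat).

Definition walsh f alpha : R[i] :=
  \sum_(x : 'rV['F_p]_n) xi_pow (f x - dot alpha x).

(* p ^ (n / 2), as a complex number *)
Definition root_pn : R[i] := (Num.sqrt (p%:R ^+ n : R))%:C.

Definition bent f := forall alpha, `|walsh f alpha| = root_pn.

Definition mu : R[i] := if (p ^ n == 1 %[mod 4])%N then 1 else 'i.

(* For p an odd prime and f bent there is exactly one such j; the default
   value 0 is only reached outside that situation. *)
Definition bent_dual f alpha : 'F_p :=
  odflt 0 [pick j : 'F_p |
    (walsh f alpha == mu * root_pn * xi_pow j)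
    || (walsh f alpha == - (mu * root_pn * xi_pow j))].

Definition weakly_regular f :=
  exists2 lambda : R[i], lambda \in [:: 1; -1; 'i; - 'i] &
    forall alpha, walsh f alpha = lambda * root_pn * xi_pow (bent_dual f alpha).

Definition dual_bent f := bent f /\ bent (bent_dual f).

Definition Bplus f : {set 'rV['F_p]_n} :=
  [set alpha | walsh f alpha == mu * root_pn * xi_pow (bent_dual f alpha)].

Definition Bminus f : {set 'rV['F_p]_n} :=
  [set alpha | walsh f alpha == - (mu * root_pn * xi_pow (bent_dual f alpha))].

Definition cset f (j : 'F_p) : {set 'rV['F_p]_n} :=
  [set x in Bplus (bent_dual f) | f x == j].

Definition dset f (j : 'F_p) : {set 'rV['F_p]_n} :=
  [set x in Bminus (bent_dual f) | f x == j].

Definition DBF f :=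
  [/\ dual_bent f,
      f 0 = 0 &
      exists h : nat,
        [/\ (0 < h)%N, gcdn h.-1 p.-1 = 1%N &
            forall (a : 'F_p) (x : 'rV['F_p]_n), a != 0 ->
              f (a *: x) = a ^+ h * f x]].

End Bent.

(* [uniq] is needed because [partition] only sees the underlying set of blocks;
   [partition] itself requires the blocks to be nonempty. *)
Definition is_partition (T : finType) (k : nat) (U : k.-tuple {set T}) :=
  uniq U && partition [set A in U] [set: T].

Definition transpose_rel (X : finType) (A : {set X * X}) : {set X * X} :=
  [set xy | (xy.2, xy.1) \in A].

Record association_scheme (X : finType) (d : nat)
    (Rs : d.+1.-tuple {set X * X}) : Prop := AssociationScheme {
  scheme_nonempty : (0 < #|X|)%N;
  scheme_partition : is_partition Rs;
  scheme_diag : tnth Rs ord0 = [set xy | xy.1 == xy.2];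
  scheme_transpose : forall j, exists j',
    transpose_rel (tnth Rs j) = tnth Rs j';
  scheme_regular : forall u v w, exists c : nat, forall x y,
    (x, y) \in tnth Rs w ->
    #|[set z | ((x, z) \in tnth Rs u) && ((z, y) \in tnth Rs v)]| = c
}.

Definition symmetric_scheme (X : finType) (d : nat)
    (Rs : d.+1.-tuple {set X * X}) : Prop :=
  association_scheme Rs /\
  forall j, transpose_rel (tnth Rs j) = tnth Rs j.

Definition difference_rel (p n : nat) (A : {set 'rV['F_p]_n}) :
    {set 'rV['F_p]_n * 'rV['F_p]_n} :=
  [set xy | xy.1 - xy.2 \in A].

Definition induces_symmetric_scheme (p n d : nat)
    (U : d.+1.-tuple {set 'rV['F_p]_n}) : Prop :=
  [/\ is_partition U,
      tnth U ord0 = [set 0] &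
      symmetric_scheme [tuple of map (@difference_rel p n) U]].

(* Main.v *)
(* With xi = e^(2 i pi / p) and G = mu p^(n/2), the sum of xi^(f(x) - al.x) over x
   in D = B_-(f^* ) is supported on the subspace E (B_-(f) or B_+(f) according to
   p modulo 4), where it equals G xi^(f^*(al)) up to a sign; the sum over the
   complement of D is supported on the complement of E. This rests on the theorem
   of Kumar, Scholtz and Welch that Walsh coefficients of bent functions have the
   form +- G xi^j, and on f^** = f. Galois conjugation and the homogeneity of f and
   of its dual then show that the Fourier transforms of the blocks depend only on
   whether al is 0, lies in the orthogonal of D, lies in E, and on the quadratic
   character of f^*(al). This gives as many classes of frequencies as there are
   blocks, so the span of the blocks is closed under convolution. When
   r = (n+1)/2, which of the sets d_SQ, d_NSQ is empty depends on the sign of the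
   quadratic Gauss sum; that sign is found by comparing moments modulo p of the
   coefficients of the Gauss sum and of a product of (p-1)/2 differences of roots
   of unity. *)

Require Import Defs.
From mathcomp Require Import all_boot all_order all_algebra.
From mathcomp Require Import all_fingroup all_solvable all_field.
From mathcomp Require Import complex reals trigo.
From mathcomp Require Import zify ring lra.

Set Implicit Arguments.
Unset Strict Implicit.
Unset Printing Implicit Defensive.

Import Order.TTheory GRing.Theory Num.Theory.
Local Open Scope ring_scope.

(** * The quadratic character of F_p *)

(** Sums of powers of xi are handled through their integer coefficients, functions on F_p determined
    up to an additive constant because 1 + xi + ... + xi^(p-1) = 0 is the only relation. Replacing
    xi by xi^y then only moves coefficients, and divisibility by the Gauss sum becomes a congruence:
    in F_p[X]/(X^p - 1) = F_p[X]/(X - 1)^p the order of vanishing at 1 is read off from the moments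
    sum_i a_i i^l. The blocks are cut out by a fixed complex number mu, so the coefficients of G are
    needed exactly: they are p^((n-1)/2) times the quadratic character, with a plus sign. Evaluating
    the sums at al = 0 then gives the sizes of the fibres of f on D and on its complement. That the
    double dual is f comes from parity: p^((n-1)/2) is odd, and a sum of two signs is even. The
    count of labels must match the count of blocks. For r = (n+1)/2 the orthogonal of D is a
    hyperplane of E, so the dual has one quadratic character on the rest of E and two labels
    disappear; two blocks disappear as well, one empty fibre class on D and the zero fibre outside
    the orthogonal of E. *)

Definition qchar (p : nat) (a : 'F_p) : int :=
  if a == 0 then 0 else if a ^+ p.-1./2 == 1 then 1 else -1.

Section QuadraticCharacter.
Variable p : nat.
Hypotheses (p_prime : prime p) (p_odd : odd p).
Local Notation m := (p.-1./2).
Implicit Types a b : 'F_p.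

Lemma prime_half_double : p.-1 = (m + m)%N.
Proof.
have p0 := prime_gt0 p_prime.
by rewrite addnn -[LHS]odd_double_half -subn1 oddB // p_odd.
Qed.

Lemma prime_half_gt0 : (0 < m)%N.
Proof. by have := prime_half_double; have := prime_gt1 p_prime; lia. Qed.

Lemma Fp_exp_pred a : a != 0 -> a ^+ p.-1 = 1.
Proof.
move=> a0; apply: (mulfI a0); rewrite mulr1 -exprS prednK ?prime_gt0 //.
by rewrite -[in RHS](expf_card a) card_Fp.
Qed.

Lemma Fp_nat_eq0 k : (k%:R == 0 :> 'F_p) = (p %| k)%N.
Proof. by rewrite (dvdn_pcharf (pchar_Fp p_prime)). Qed.

Lemma Fp_two_neq0 : 2%:R != 0 :> 'F_p.
Proof.
rewrite Fp_nat_eq0; apply/negP => /dvdn_leq -/(_ isT).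
by have := prime_gt1 p_prime; case: p p_odd => [|[|[|]]].
Qed.

Lemma Fp_int_eq0 (k : int) : (k%:~R == 0 :> 'F_p) = (p%:Z %| k)%Z.
Proof.
by case: k => k; rewrite ?NegzE ?mulrNz ?oppr_eq0 Fp_nat_eq0 dvdzE ?abszN.
Qed.

Lemma Fp_exp_half a : a != 0 -> a ^+ m = 1 \/ a ^+ m = -1.
Proof.
move=> a0; suff /orP[/eqP|/eqP]: (a ^+ m == 1) || (a ^+ m == -1) by [left|right].
by rewrite -sqrf_eq1 -exprM muln2 -addnn -prime_half_double Fp_exp_pred.
Qed.

Lemma Fp_one_neqN1 : (1 : 'F_p) != -1.
Proof. by rewrite -subr_eq0 opprK Fp_two_neq0. Qed.

Lemma qchar_Fp a : (qchar a)%:~R = a ^+ m :> 'F_p.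
Proof.
rewrite /qchar; case: eqP => [->|/eqP a0]; first by rewrite expr0n gtn_eqF ?prime_half_gt0.
by case: (Fp_exp_half a0) => ->; rewrite ?eqxx // eq_sym (negPf Fp_one_neqN1).
Qed.

Lemma qchar0 : qchar (0 : 'F_p) = 0. Proof. by rewrite /qchar eqxx. Qed.

Lemma qchar1 : qchar (1 : 'F_p) = 1.
Proof. by rewrite /qchar oner_eq0 expr1n eqxx. Qed.

Lemma qchar_pm1 a : a != 0 -> qchar a = 1 \/ qchar a = -1.
Proof. by rewrite /qchar => /negPf ->; case: ifP; [left|right]. Qed.

Lemma qchar_eq0 a : (qchar a == 0) = (a == 0).
Proof. by rewrite /qchar; case: (a == 0) => //; case: ifP. Qed.

(** Since p >= 3, a congruence between integers at distance at most 2 is an equality. This lifts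
    identities between signs from F_p to the integers. *)
Lemma Fp_int_small_inj (x y : int) : `|x - y| <= 2 -> x%:~R = y%:~R :> 'F_p -> x = y.
Proof.
move=> xy2 /eqP; rewrite -subr_eq0 -mulrzBr Fp_int_eq0 dvdzE => dv.
have p3 : (3 <= p)%N by have := prime_gt1 p_prime; case: p p_odd => [|[|[|]]].
have [/eqP|z] := eqVneq (x - y) 0; first by rewrite subr_eq0 => /eqP.
by have := dvdn_leq _ dv; lia.
Qed.

Lemma qcharM a b : qchar (a * b) = qchar a * qchar b.
Proof.
have [->|a0] := eqVneq a 0; first by rewrite mul0r qchar0 mul0r.
have [->|b0] := eqVneq b 0; first by rewrite mulr0 qchar0 mulr0.
have ab0 : a * b != 0 by rewrite mulf_neq0.
apply: Fp_int_small_inj; last by rewrite rmorphM /= !qchar_Fp exprMn.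
by case: (qchar_pm1 ab0) (qchar_pm1 a0) (qchar_pm1 b0) => -> [] -> [] ->.
Qed.

Lemma qchar_sqr a : a != 0 -> qchar (a ^+ 2) = 1.
Proof. by rewrite expr2 qcharM; case/qchar_pm1 => ->. Qed.

Lemma qchar_norm a : a != 0 -> qchar a * qchar a = 1.
Proof. by case/qchar_pm1 => ->. Qed.

Lemma qcharX_even a k : ~~ odd k -> a != 0 -> qchar (a ^+ k) = 1.
Proof.
move=> ok a0.
by rewrite -(odd_double_half k) (negPf ok) add0n -muln2 exprM qchar_sqr // expf_neq0.
Qed.

Lemma qcharV a : qchar a^-1 = qchar a.
Proof.
have [->|a0] := eqVneq a 0; first by rewrite invr0.
have := qcharM a a^-1; rewrite divff // qchar1.
by case: (qchar_pm1 a0) => ->; lia.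
Qed.

Lemma Fp_generator :
  exists w : 'F_p, [/\ w != 0, forall a, a != 0 -> exists i, a = w ^+ i &
                       forall i, w ^+ i = 1 -> (p.-1 %| i)%N].
Proof.
have /cyclicP[w dw] := field_unit_group_cyclic [set: {unit 'F_p}]%G.
exists (val w); split=> [|a a0|i wi].
- by rewrite -unitfE (valP w).
- have ua : a \is a GRing.unit by rewrite unitfE.
  have : FinRing.unit 'F_p ua \in <[w]>%g by rewrite -dw inE.
  by case/cycleP=> i /(congr1 val) /= ->; exists i; rewrite FinRing.val_unitX.
- rewrite -(card_Fp p_prime) -card_finField_unit dw order_dvdn.
  by apply/eqP/val_inj; rewrite FinRing.val_unitX wi.
Qed.

(** Multiplication by a generator w permutes F_p and scales the sum by w^e, which is not 1 for 0 < e
    < p - 1. For e = 0 the convention 0^0 = 1 makes the sum equal to p. *)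
Lemma Fp_sum_exp e : (e < p.-1)%N -> \sum_(a : 'F_p) a ^+ e = 0.
Proof.
case: e => [_|e ep].
  under eq_bigr do rewrite expr0.
  by rewrite sumr_const cardT -cardE card_Fp // pchar_Fp_0.
have [w [w0 _ ordw]] := Fp_generator.
have we : w ^+ e.+1 != 1 by apply/eqP => /ordw /dvdn_leq; lia.
apply/eqP; move: we; rewrite -subr_eq0 => /mulfI/inj_eq <-; rewrite mulr0.
rewrite mulrBl mul1r mulr_sumr subr_eq0.
rewrite [X in _ == X](reindex_inj (mulfI w0)) /=.
by under [X in _ == X]eq_bigr do rewrite exprMn.
Qed.

Lemma Fp_sum_exp_pred : \sum_(a : 'F_p) a ^+ p.-1 = -1.
Proof.
have p2 : (0 < p.-1)%N by have := prime_gt1 p_prime; lia.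
rewrite (bigD1 0) //= expr0n gtn_eqF // add0r.
under eq_bigr => a a0 do rewrite Fp_exp_pred //.
rewrite sumr_const; apply/eqP; rewrite -subr_eq0 opprK -mulrSr.
by rewrite cardC1 card_Fp // prednK ?prime_gt0 // pchar_Fp_0.
Qed.

(** On powers of a generator w, w^(i m) = 1 forces 2m to divide i m, so i is even. *)
Lemma qchar_eq1_sqr a : qchar a = 1 -> exists b, a = b ^+ 2.
Proof.
have [->|a0] := eqVneq a 0; first by rewrite qchar0.
have [w [w0 genw ordw]] := Fp_generator.
have [i ->] := genw _ a0; move=> /(congr1 (fun z : int => z%:~R : 'F_p)).
rewrite qchar_Fp -exprM => /ordw; rewrite {1}prime_half_double addnn -mul2n.
rewrite dvdn_pmul2r ?prime_half_gt0 // => /dvdnP[k ->].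
by exists (w ^+ k); rewrite exprM.
Qed.

Lemma exists_qcharN1 : exists a : 'F_p, qchar a = -1.
Proof.
have [w [w0 genw ordw]] := Fp_generator.
exists w; case: (qchar_pm1 w0) => // w1.
have := qchar_Fp w; rewrite w1 => /esym/ordw/dvdn_leq.
by have := prime_half_gt0; have := prime_half_double; lia.
Qed.

Lemma sum_qchar : \sum_(a : 'F_p) qchar a = 0.
Proof.
have [b b1] := exists_qcharN1.
have b0 : b != 0 by rewrite -qchar_eq0 b1.
suff : \sum_(a : 'F_p) qchar a = - \sum_(a : 'F_p) qchar a by lia.
rewrite [LHS](reindex_inj (mulfI b0)) /= -sumrN.
by apply: eq_bigr => a _; rewrite qcharM b1 mulN1r.
Qed.

Lemma mem_SQ a : (a \in SQ p) = (qchar a == 1).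
Proof.
rewrite inE; apply/andP/eqP => [[a0 /existsP[b /eqP ab]]|a1].
  by rewrite ab qchar_sqr //; apply: contraNneq a0 => b0; rewrite ab b0 expr0n.
rewrite -qchar_eq0 a1; split=> //; apply/existsP.
by have [b ->] := qchar_eq1_sqr a1; exists b.
Qed.

Lemma mem_NSQ a : (a \in NSQ p) = (qchar a == -1).
Proof.
have := mem_SQ a; rewrite !inE; have [->|a0] /= := eqVneq a 0; first by rewrite qchar0.
by move=> ->; case: (qchar_pm1 a0) => ->.
Qed.

Lemma Fp_sqr_class a b : qchar a = qchar b -> exists2 c, c != 0 & b = c ^+ 2 * a.
Proof.
have [->|a0] := eqVneq a 0.
  by rewrite qchar0 => /esym/eqP; rewrite qchar_eq0 => /eqP ->; exists 1; rewrite ?oner_eq0 ?mulr0.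
move=> ab; have /qchar_eq1_sqr[c bc] : qchar (b / a) = 1.
  by rewrite qcharM qcharV -ab qchar_norm.
have b0 : b != 0 by rewrite -qchar_eq0 -ab qchar_eq0.
exists c; last by rewrite -bc divfK.
by apply: contraNneq b0 => c0; rewrite -(divfK a0 b) bc c0 expr0n mul0r.
Qed.

Lemma qcharN1 : qchar (-1 : 'F_p) = (-1) ^+ m.
Proof.
apply: Fp_int_small_inj; last by rewrite qchar_Fp rmorphXn /= rmorphN1.
have N1 : (-1 : 'F_p) != 0 by rewrite oppr_eq0 oner_eq0.
by rewrite -signr_odd; case: (qchar_pm1 N1) => ->; case: odd.
Qed.

End QuadraticCharacter.

(** * Moments modulo p *)

(** The value at X = 1 of (X d/dX)^l applied to sum_i a_i X^i; here 0^0 = 1. *)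
Definition moment (p : nat) (a : 'F_p -> 'F_p) (l : nat) : 'F_p := \sum_i a i * i ^+ l.

Section Moments.
Variable p : nat.
Hypotheses (p_prime : prime p) (p_odd : odd p).
Local Notation m := (p.-1./2).

Lemma prime_ndvd_fact k : (k < p)%N -> ~~ (p %| k`!)%N.
Proof.
elim: k => [_|k IHk kp]; first by rewrite dvdn1 neq_ltn prime_gt1 ?orbT.
by rewrite factS Euclid_dvdM // negb_or IHk ?(ltnW kp) // gtnNdvd.
Qed.

Lemma moment_translate (a : 'F_p -> 'F_p) k l :
  \sum_i a (i - k) * i ^+ l = \sum_(s < l.+1) 'C(l, s)%:R * k ^+ s * moment a (l - s).
Proof.
rewrite (reindex_inj (addIr k)) /=.
under eq_bigr => i _ do rewrite addrK exprDn mulr_sumr.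
rewrite exchange_big /=; apply: eq_bigr => s _.
rewrite /moment mulr_sumr; apply: eq_bigr => i _; rewrite -mulr_natl; ring.
Qed.

(** Summing c k^(2l) over k gives 0 because 2l < p - 1. Expanding (i - j)^(2l) turns the same sum
    into products of moments of orders s and 2l - s; by induction only s = l survives, and its
    coefficient, the central binomial of 2l up to sign, is prime to p. Hence the square of the l-th
    moment vanishes. *)
Lemma moment_autocorrelation (a : 'F_p -> 'F_p) (c : 'F_p) :
  (forall k : 'F_p, \sum_j a (j + k) * a j = c) -> forall l, (l < m)%N -> moment a l = 0.
Proof.
have shuffle (K : comNzRingType) (x y z t u : K) :
    x * (y * (z * t) * u) = y * z * u * (x * t) by ring.
move=> ac; elim/ltn_ind => l IHl lm.
have lp : (l + l < p.-1)%N by rewrite (prime_half_double p_prime p_odd); lia.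
have : \sum_(k : 'F_p) (\sum_j a (j + k) * a j) * k ^+ (l + l) = 0.
  by under eq_bigr do rewrite ac; rewrite -mulr_sumr Fp_sum_exp // mulr0.
have -> : \sum_(k : 'F_p) (\sum_j a (j + k) * a j) * k ^+ (l + l)
        = \sum_(j : 'F_p) a j * (\sum_i a (i - (- j)) * i ^+ (l + l)).
  under eq_bigr do rewrite mulr_suml; rewrite exchange_big; apply: eq_bigr => j _.
  by rewrite mulr_sumr; apply: eq_bigr => k _; rewrite opprK [k + j]addrC mulrA [a j * _]mulrC.
under eq_bigr do rewrite moment_translate mulr_sumr.
rewrite exchange_big /=.
have ll : (l < (l + l).+1)%N by lia.
rewrite (bigD1 (Ordinal ll)) //= [X in _ + X]big1 ?addr0 => [|s sl]; last first.
  transitivity ('C(l + l, s)%:R * (-1) ^+ s * moment a (l + l - s) * moment a s).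
    rewrite [moment a s]/moment mulr_sumr; apply: eq_bigr => j _.
    by rewrite (exprNn j); exact: shuffle.
  have sl' : s != l :> nat by apply: contraNneq sl => sl; apply/eqP/val_inj.
  have [sltl|sgtl] : (s < l)%N \/ (l + l - s < l)%N by have := ltn_ord s; lia.
    by rewrite (IHl s) ?mulr0 //; lia.
  by rewrite (IHl (l + l - s)%N) ?mulr0 ?mul0r //; lia.
have -> : \sum_(i : 'F_p) a i * ('C(l + l, l)%:R * (- i) ^+ l * moment a (l + l - l))
    = 'C(l + l, l)%:R * (-1) ^+ l * moment a l ^+ 2.
  rewrite addnK expr2 mulrA {2}/moment mulr_sumr; apply: eq_bigr => j _.
  by rewrite (exprNn j); exact: shuffle.
move/eqP; rewrite mulf_eq0 [X in X || _]mulf_eq0 !expf_eq0 oppr_eq0 oner_eq0 andbF orbF => /orP[|/andP[_ /eqP]//].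
rewrite Fp_nat_eq0 // => /(dvdn_mulr (l`! * (l + l - l)`!)).
by rewrite bin_fact ?leq_addr // (negPf (prime_ndvd_fact _)) //; lia.
Qed.

(** When all lower moments vanish, the l-th moment is invariant under translation. *)
Lemma moment_cross_correlation (a : 'F_p -> 'F_p) l k :
  (forall s, (s < l)%N -> moment a s = 0) -> \sum_j a (j + k) * j ^+ l = moment a l.
Proof.
move=> a0; have := moment_translate a (- k) l.
under eq_bigr do rewrite opprK.
move=> ->; rewrite big_ord_recl big1 => [|s _]; first by rewrite bin0 expr0 !mul1r subn0 addr0.
by rewrite a0 ?mulr0 // lift0; have := ltn_ord s; lia.
Qed.

(* The coefficients of [\prod_(1 <= k < t.+1) (X^(k * (m + 1)) - X^(k * m))]
   modulo [X^p - 1]. *)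
Fixpoint half_product (t : nat) (j : 'F_p) : int :=
  if t is t'.+1 then
    half_product t' (j - (t * m.+1)%:R) - half_product t' (j - (t * m)%:R)
  else (j == 0)%:Z.

(** Each factor vanishes to order one at X = 1. Passing from t to t + 1 multiplies the leading
    moment by the binomial coefficient t + 1 and by the difference t + 1 of the two shifts, whence
    the square of the factorial. *)
Lemma moment_half_product t l : (l <= t)%N ->
  moment (fun j => (half_product t j)%:~R) l = (if l == t then (t`! ^ 2)%N%:R else 0).
Proof.
elim: t l => [|t IHt] l lt.
  rewrite leqn0 in lt; rewrite lt (eqP lt) /moment (bigD1 0) //= big1 ?addr0 ?eqxx ?mulr1 //.
  by move=> i /negPf ->; rewrite mul0r.
have -> : moment (fun j => (half_product t.+1 j)%:~R) l
  = \sum_i (half_product t (i - (t.+1 * m.+1)%:R))%:~R * i ^+ l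
    - \sum_i (half_product t (i - (t.+1 * m)%:R))%:~R * i ^+ l :> 'F_p.
  by rewrite -sumrB; apply: eq_bigr => j _ /=; rewrite rmorphB /= mulrBl.
rewrite !(moment_translate (fun i => (half_product t i)%:~R)) -sumrB.
rewrite big_ord_recl !expr0 subrr add0r.
case: l lt => [|l] lt; first by rewrite big_ord0.
rewrite big_ord_recl big1 ?addr0 => [|s _]; last first.
  rewrite !lift0 IHt; last by have := ltn_ord s; lia.
  by rewrite ifN ?mulr0 ?subrr //; have := ltn_ord s; lia.
rewrite lift0 /= subSS subn0 bin1 !expr1 IHt // eqSS; case: eqP => [->|_]; last by rewrite !mulr0 subrr.
rewrite -mulrBl -mulrBr factS -natrB ?leq_mul2l ?leqnSn ?orbT // -mulnBr subSnn muln1.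
by rewrite -!natrM; congr (_%:R); ring.
Qed.

(** Wilson's theorem, with the factors above m rewritten as p - i for 1 <= i <= m. *)
Lemma half_factorial_sqr : (m`! ^ 2)%N%:R = - (-1) ^+ m :> 'F_p.
Proof.
have wil : (p.-1)`!%:R = -1 :> 'F_p.
  apply/eqP; rewrite -subr_eq0 opprK natr1 Fp_nat_eq0 //.
  by rewrite -Wilson ?prime_gt1.
have : (p.-1)`!%:R = (m`! ^ 2)%N%:R * (-1) ^+ m :> 'F_p.
  rewrite !fact_prod expnS expn1 [X in index_iota 1 X]prednK ?prime_gt0 //.
  rewrite (@big_cat_nat _ _ _ m.+1) //=; last by have := prime_half_double p_prime p_odd; lia.
  have pm : (p - m.+1 = m)%N by have := prime_half_double p_prime p_odd; lia.
  rewrite natrM -[X in index_iota X p]add0n big_addn pm big_nat_rev /=.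
  rewrite natrM -mulrA; congr (_ * _).
  have -> : (-1) ^+ m = \prod_(0 <= i < m) (-1) :> 'F_p by rewrite prodr_const_nat subn0.
  rewrite big_add1 /= !natr_prod -big_split /=.
  apply: eq_big_nat => i /andP[_ im].
  have -> : (i + m.+1 = p - (1 + m.+1 - i.+2))%N by lia.
  by rewrite mulrN1 natrB ?pchar_Fp_0 ?sub0r //; lia.
rewrite wil => /(congr1 (fun x => x * (-1) ^+ m)).
by rewrite -mulrA -expr2 sqrr_sign mulr1 mulN1r => <-.
Qed.

End Moments.

(** * Linear relations between p-th roots of unity *)

Lemma prime_unity_root_primitive (F : fieldType) (p : nat) (z : F) :
  prime p -> z ^+ p = 1 -> z != 1 -> p.-primitive_root z.
Proof.
move=> pp zp z1; have [k pk kp] := prim_order_exists (prime_gt0 pp) zp.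
case/primeP: pp => _ /(_ k kp) /orP[/eqP k1|/eqP <- //].
by move: pk z1; rewrite k1 => /prim_expr_order; rewrite expr1 => ->; rewrite eqxx.
Qed.

Lemma horner_sum_Xn (F : fieldType) n (z : F) :
  z ^+ n = 1 -> z != 1 -> (\poly_(i < n) 1).[z] = 0.
Proof.
move=> zn z1; apply: (@mulfI _ (z - 1)); first by rewrite subr_eq0.
rewrite mulr0 horner_poly; under eq_bigr do rewrite mul1r.
by rewrite -subrX1 zn subrr.
Qed.

Lemma map_horner_poly (F K : fieldType) (h : {rmorphism F -> K}) n (a : nat -> F) (z : K) :
  (map_poly h (\poly_(i < n) a i)).[z] = \sum_(i < n) h (a i) * z ^+ i.
Proof.
rewrite (@horner_coef_wide _ n) ?size_map_poly ?size_poly //.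
by apply: eq_bigr => i _; rewrite coef_map coef_poly ltn_ord.
Qed.

(** The relation q and s = 1 + X + ... + X^(p-1) both vanish at x, so they are not coprime over the
    rationals and share a root z in [algC], which is again a primitive p-th root of unity. Its
    minimal polynomial has degree p - 1, so q and s are scalar multiples of it, and q has constant
    coefficients like s. *)
Lemma prime_root_rational_relation (K : numFieldType) (p : nat) (x : K) (a : nat -> rat) :
  prime p -> p.-primitive_root x -> \sum_(i < p) ratr (a i) * x ^+ i = 0 ->
  forall i, (i < p)%N -> a i = a 0%N.
Proof.
move=> pp px ax0.
pose q : {poly rat} := \poly_(i < p) a i.
pose s : {poly rat} := \poly_(i < p) 1.
have x1 : x != 1 by rewrite -(expr1 x) -(prim_order_dvd px) dvdn1 neq_ltn prime_gt1 ?orbT.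
have evq : (map_poly ratr q).[x] = 0.
  by rewrite map_horner_poly.
have evs : (map_poly (ratr : rat -> K) s).[x] = 0.
  rewrite map_horner_poly; have := horner_sum_Xn (prim_expr_order px) x1.
  by rewrite horner_poly => {2}<-; apply: eq_bigr => i _; rewrite rmorph1.
have ncop : ~~ coprimep q s.
  apply/negP => /Bezout_eq1_coprimepP[[u v] /= uv].
  have := congr1 (fun t => (map_poly (ratr : rat -> K) t).[x]) uv.
  rewrite rmorphD !rmorphM rmorph1 !hornerE evq evs !mulr0 addr0 => /eqP.
  by rewrite eq_sym oner_eq0.
have [z rz] : exists z : algC, root (map_poly ratr (gcdp q s)) z.
  by apply/closed_rootP; rewrite size_map_poly.
have rqs : root (map_poly ratr q) z && root (map_poly ratr s) z.
  by rewrite -root_gcd -gcdp_map.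
case/andP: rqs => rq rs.
have rs' : (\poly_(i < p) 1).[z] = 0.
  move/rootP: rs; rewrite map_horner_poly horner_poly => {2}<-.
  by apply: eq_bigr => i _; rewrite rmorph1.
have z1 : z != 1.
  apply/eqP => z1; move: rs'; rewrite horner_poly z1.
  under eq_bigr do rewrite expr1n mulr1.
  by rewrite sumr_const card_ord => /eqP; rewrite pnatr_eq0 gtn_eqF ?prime_gt0.
have zp : z ^+ p = 1.
  apply/eqP; rewrite -subr_eq0 subrX1; move: rs'; rewrite horner_poly.
  by under eq_bigr do rewrite mul1r; move=> ->; rewrite mulr0.
have pz := prime_unity_root_primitive pp zp z1.
have [f [mf fm fdv]] := minCpolyP z.
have szf : size f = p.
  rewrite -(size_map_poly (ratr : {rmorphism rat -> algC})) -mf (minCpoly_cyclotomic pz).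
  by rewrite size_cyclotomic totient_prime // prednK ?prime_gt0.
have multiple (t : {poly rat}) : (size t <= p)%N -> root (map_poly ratr t) z ->
    exists c, t = c *: f.
  rewrite fdv => szt /dvdpP[g tg]; have [g0|g0] := eqVneq g 0.
    by exists 0; rewrite scale0r tg g0 mul0r.
  have : (size g <= 1)%N.
    move: szt; rewrite tg size_mul // ?monic_neq0 // szf.
    by rewrite -subn1 leq_subLR leq_add2r.
  by move/size1_polyC => gE; exists g`_0; rewrite tg {1}gE mul_polyC.
have [c qc] := multiple q (size_poly _ _) rq.
have [d sd] := multiple s (size_poly _ _) rs.
have coef_s i : (i < p)%N -> d * f`_i = 1.
  by move=> ip; rewrite -coefZ -sd coef_poly ip.
have coef_f i : (i < p)%N -> f`_i = d^-1.
  move=> ip; have := coef_s i ip; have [->|d0 dfi] := eqVneq d 0.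
    by rewrite mul0r => /esym/eqP; rewrite oner_eq0.
  by apply: (mulfI d0); rewrite dfi divff.
have coef_q i : (i < p)%N -> a i = c * d^-1.
  by move=> ip; rewrite -(coef_f i ip) -coefZ -qc coef_poly ip.
by move=> i ip; rewrite !coef_q ?prime_gt0.
Qed.

(** * The additive character of F_p with values in the powers of xi *)

Section AdditiveCharacter.
Variables (R : realType) (p : nat).
Hypotheses (p_prime : prime p) (p_odd : odd p).
Local Notation C := (R[i]).
Local Open Scope complex_scope.

Definition cis (t : R) : C := cos t +i* sin t.

Lemma cisD s t : cis (s + t) = cis s * cis t.
Proof. by rewrite /cis cosD sinD; simpc; rewrite [X in _ +i* X]addrC. Qed.

Lemma cis0 : cis 0 = 1. Proof. by rewrite /cis cos0 sin0. Qed.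

Lemma cisX t k : cis t ^+ k = cis (t *+ k).
Proof. by elim: k => [|k IHk]; rewrite ?cis0 // exprS mulrS cisD IHk. Qed.

Lemma conj_cis t : (cis t)^*%R = cis (- t).
Proof. by rewrite /cis cosN sinN. Qed.

Lemma cisJ t : cis t * (cis t)^*%R = 1.
Proof. by rewrite conj_cis -cisD subrr cis0. Qed.

Lemma cis_pi : cis pi = -1.
Proof. by rewrite /cis cospi sinpi; apply/eqP; rewrite eq_complex /= oppr0 !eqxx. Qed.

Local Notation xi := (xi R p).

Lemma p_neq0 : p%:R != 0 :> R.
Proof. by rewrite pnatr_eq0 gtn_eqF ?prime_gt0. Qed.

Lemma xi_expr_p : xi ^+ p = 1.
Proof.
rewrite -[xi]/(cis _) cisX -[_ *+ p]mulr_natr divfK ?p_neq0 // mulr2n mulrDl !mul1r.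
by rewrite cisD cis_pi mulrNN mul1r.
Qed.

Lemma xi_neq1 : xi != 1.
Proof.
rewrite eq_complex negb_and; apply/orP; right => /=.
apply/lt0r_neq0/sin_gt0_pi.
have p3 : 3%:R <= p%:R :> R.
  by rewrite ler_nat; have := prime_gt1 p_prime; case: p p_odd => [|[|[|]]].
have := pi_gt0 R => pi0.
have p0 : 0 < p%:R :> R by lra.
by rewrite divr_gt0 //=; [rewrite ltr_pdivrMr //; nra | lra].
Qed.

Lemma xi_primitive : p.-primitive_root xi.
Proof. exact: prime_unity_root_primitive xi_expr_p xi_neq1. Qed.

Local Notation chi := (@xi_pow R p).

Lemma xi_pow_nat k : chi k%:R = xi ^+ k.
Proof.
by rewrite /xi_pow val_Fp_nat // (expr_mod _ xi_expr_p).
Qed.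

Lemma xi_pow0 : chi 0 = 1. Proof. by rewrite /xi_pow expr0. Qed.

Lemma xi_powD a b : chi (a + b) = chi a * chi b.
Proof. by rewrite -[a]natr_Zp -[b]natr_Zp -natrD !xi_pow_nat exprD. Qed.

Lemma xi_pow_conjM a : chi a * (chi a)^*%R = 1.
Proof. by rewrite /xi_pow rmorphXn /= -exprMn cisJ expr1n. Qed.

Lemma xi_powNM a : chi (- a) * chi a = 1.
Proof. by rewrite -xi_powD addNr xi_pow0. Qed.

Lemma xi_pow_neq0 a : chi a != 0.
Proof. by apply/eqP => a0; have /eqP := xi_powNM a; rewrite a0 mulr0 eq_sym oner_eq0. Qed.

Lemma conj_xi_pow a : (chi a)^*%R = chi (- a).
Proof. by apply: (mulfI (xi_pow_neq0 a)); rewrite xi_pow_conjM mulrC xi_powNM. Qed.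

Lemma xi_pow_eq1 a : (chi a == 1) = (a == 0).
Proof.
rewrite /xi_pow -(prim_order_dvd xi_primitive); apply/idP/eqP => [pa|->]; last exact: dvdn0.
apply: val_inj => /=; apply: contraTeq pa => a0; rewrite gtnNdvd ?lt0n //.
by rewrite -[X in (_ < X)%N](Fp_cast p_prime) ltn_ord.
Qed.

Lemma xi_pow_inj : injective chi.
Proof.
move=> a b ab; apply/eqP; rewrite -subr_eq0 -xi_pow_eq1 xi_powD ab mulrC xi_powNM //.
Qed.

Lemma sum_Fp_val (F : 'F_p -> C) : \sum_(j : 'F_p) F j = \sum_(i < p) F i%:R.
Proof.
rewrite (reindex (fun i : 'I_p => inZp i : 'F_p)) /=; last first.
  exists (fun j : 'F_p => cast_ord (Fp_cast p_prime) j) => i _; apply: val_inj => /=.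
    by rewrite modn_small // Fp_cast.
  by rewrite modn_small // ltn_ord.
by apply: eq_bigr => i _; congr F; apply: val_inj; rewrite /= val_Fp_nat // Fp_cast.
Qed.

(** This is the tool for comparing coefficients: two integer combinations of powers of xi with the
    same value have coefficients that differ by a common constant. *)
Lemma xi_pow_relation (a : 'F_p -> int) :
  \sum_j (a j)%:~R * chi j = 0 -> forall i j, a i = a j.
Proof.
rewrite sum_Fp_val => a0.
have key := prime_root_rational_relation (a := fun i => (a i%:R)%:~R) p_prime xi_primitive.
suff ai i : a i = a 0 by move=> i j; rewrite !ai.
have ip : (i < p)%N by rewrite -[X in (_ < X)%N](Fp_cast p_prime) ltn_ord.
have := key _ i ip; rewrite natr_Zp => /(_ _)/intr_inj -> //.
by rewrite -[RHS]a0; apply: eq_bigr => k _; rewrite ratr_int xi_pow_nat.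
Qed.

Lemma sum_xi_pow : \sum_j chi j = 0.
Proof.
rewrite sum_Fp_val; have := horner_sum_Xn xi_expr_p xi_neq1.
by rewrite horner_poly => {2}<-; apply: eq_bigr => i _; rewrite mul1r xi_pow_nat.
Qed.

End AdditiveCharacter.

Lemma big_nat_fold_half (T : Type) (idx : T) (op : Monoid.com_law idx) (m : nat) (F : nat -> T) :
  \big[op/idx]_(1 <= k < (m + m).+1) F k
  = \big[op/idx]_(1 <= k < m.+1) op (F k) (F ((m + m).+1 - k)%N).
Proof.
rewrite (@big_cat_nat _ _ _ m.+1) //=; last by lia.
rewrite big_split /=; congr (op _ _).
rewrite -[m.+1 in LHS]add1n big_addn big_nat_rev.
have -> : ((m + m).+1 - m = m.+1)%N by lia.
by apply: eq_big_nat => k km; congr F; lia.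
Qed.

(** * The quadratic Gauss sum and its sign *)

Section GaussSum.
Variables (R : realType) (p : nat).
Hypotheses (p_prime : prime p) (p_odd : odd p).
Local Notation C := (R[i]).
Local Notation chi := (@xi_pow R p).
Local Notation m := (p.-1./2).

Lemma sum_xi_pow_scale y : \sum_(a : 'F_p) chi (y * a) = if y == 0 then p%:R else 0.
Proof.
case: eqP => [->|/eqP y0].
  under eq_bigr do rewrite mul0r xi_pow0.
  by rewrite sumr_const cardT -cardE card_Fp.
by rewrite -[RHS](sum_xi_pow R p_prime p_odd) [RHS](reindex_inj (mulfI y0)).
Qed.

Lemma sum_xi_pow_fibres (I : finType) (P : pred I) (c : I -> int) (u : I -> 'F_p) (F : 'F_p -> C) :
  \sum_(i | P i) (c i)%:~R * F (u i) = \sum_j (\sum_(i | P i && (u i == j)) c i)%:~R * F j.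
Proof.
rewrite (partition_big u xpredT) //=; apply: eq_bigr => j _.
by rewrite rmorph_sum mulr_suml; apply: eq_bigr => i /andP[_ /eqP ->].
Qed.

Definition gauss_sum : C := \sum_a (qchar a)%:~R * chi a.

Local Notation gauss := gauss_sum.

Lemma gauss_twist y : y != 0 -> \sum_a (qchar a)%:~R * chi (y * a) = (qchar y)%:~R * gauss.
Proof.
move=> y0; rewrite /gauss_sum mulr_sumr [RHS](reindex_inj (mulfI y0)) /=.
by apply: eq_bigr => a _; rewrite qcharM // rmorphM /= !mulrA -rmorphM /= qchar_norm // mul1r.
Qed.

Lemma conj_intr_xi_pow (k : int) a : (k%:~R * chi a)^*%R = k%:~R * chi (- a).
Proof. by rewrite rmorphM /= rmorph_int conj_xi_pow. Qed.

Lemma sum_xi_pow_conjM (a b : 'F_p -> int) :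
  (\sum_j (a j)%:~R * chi j) * (\sum_j (b j)%:~R * chi j)^*%R
  = \sum_k (\sum_j a (j + k) * b j)%:~R * chi k.
Proof.
rewrite rmorph_sum mulr_sumr; under [RHS]eq_bigr do rewrite rmorph_sum mulr_suml.
rewrite [RHS]exchange_big; apply: eq_bigr => j _ /=.
rewrite mulr_suml (reindex_inj (addrI j)) /=; apply: eq_bigr => k _.
rewrite conj_intr_xi_pow rmorphM /=.
have -> : chi k = chi (j + k) * chi (- j) by rewrite -xi_powD // addrAC subrr add0r.
by rewrite mulrACA.
Qed.

Lemma gauss_conj : gauss^*%R = (qchar (-1 : 'F_p))%:~R * gauss.
Proof.
rewrite -gauss_twist ?oppr_eq0 ?oner_eq0 // rmorph_sum; apply: eq_bigr => a _ /=.
by rewrite conj_intr_xi_pow mulN1r.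
Qed.

(** By scaling j, the correlation takes one value on all k != 0; the total over k is a product with
    sum_a qchar a = 0, and the value at 0 is p - 1, so the common value is -1. *)
Lemma qchar_autocorrelation (k : 'F_p) :
  \sum_j qchar (j + k) * qchar j = (if k == 0 then p%:Z else 0) - 1.
Proof.
pose A (k : 'F_p) : int := \sum_j qchar (j + k) * qchar j.
have A0 : A 0 = p%:Z - 1.
  rewrite /A (bigD1 0) //= qchar0 mulr0 add0r.
  under eq_bigr => j j0 do rewrite addr0 qchar_norm //.
  by rewrite sumr_const cardC1 card_Fp // -mulr_natr mul1r; have := prime_gt0 p_prime; lia.
have A1 i : i != 0 -> A i = A 1.
  move=> i0; rewrite /A (reindex_inj (mulfI i0)) /=; apply: eq_bigr => j _.
  by rewrite -[X in _ + X]mulr1 -mulrDr !qcharM // mulrACA qchar_norm // mul1r.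
have sumA : \sum_i A i = 0.
  rewrite /A exchange_big big1 //= => j _.
  rewrite -mulr_suml; have := sum_qchar p_prime p_odd.
  by rewrite (reindex_inj (addrI j)) /= => ->; rewrite mul0r.
case: eqP => [->|/eqP k0]; first exact: A0.
rewrite -/(A k) A1 //; move: sumA; rewrite (bigD1 0) //= A0.
under eq_bigr => i i0 do rewrite A1 //.
rewrite sumr_const cardC1 card_Fp // -mulr_natr.
have : (p.-1)%:R = p%:Z - 1 by have := prime_gt0 p_prime; lia.
move=> -> /eqP; rewrite -{1}[p%:Z - 1]mul1r -mulrDl mulf_eq0 => /orP[|]; first lia.
by have := prime_gt1 p_prime; lia.
Qed.

Lemma gauss_norm : gauss * gauss^*%R = p%:R.
Proof.
rewrite sum_xi_pow_conjM (bigD1 0) //= qchar_autocorrelation eqxx xi_pow0 mulr1.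
under eq_bigr => k k0 do rewrite qchar_autocorrelation (negPf k0) add0r mulN1r.
rewrite sumrN; have := sum_xi_pow R p_prime p_odd; rewrite (bigD1 0) //= xi_pow0.
by move/eqP; rewrite addrC addr_eq0 => /eqP ->; rewrite opprK rmorphB /= subrK.
Qed.

Lemma gauss_neq0 : gauss != 0.
Proof.
apply/eqP => g0; have := gauss_norm; rewrite g0 mul0r => /esym/eqP.
by rewrite pnatr_eq0 gtn_eqF ?prime_gt0.
Qed.

Lemma gauss_sqr : gauss ^+ 2 = (qchar (-1 : 'F_p))%:~R * p%:R.
Proof.
have q2 : (qchar (-1 : 'F_p))%:~R * (qchar (-1 : 'F_p))%:~R = 1 :> C.
  by rewrite -rmorphM /= qchar_norm ?oppr_eq0 ?oner_eq0.
rewrite -gauss_norm gauss_conj; move: (_%:~R) q2 (gauss) => q q2 g.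
by rewrite (mulrCA q) (mulrA q) q2 mul1r.
Qed.

Lemma gauss_exp_odd k : gauss ^+ k.*2.+1 = ((qchar (-1 : 'F_p)) ^+ k * (p ^ k)%N%:Z)%:~R * gauss.
Proof.
rewrite exprSr -mul2n exprM gauss_sqr exprMn !rmorphM /= rmorphXn; congr (_ * _ * _).
by rewrite -natrX.
Qed.

Lemma half_product_sum t :
  \sum_j (half_product t j)%:~R * chi j
  = \prod_(1 <= k < t.+1) (chi (k * m.+1)%:R - chi (k * m)%:R).
Proof.
elim: t => [|t IHt].
  rewrite big_geq // (bigD1 0) //= xi_pow0 big1 ?addr0 ?mulr1 // => j /negPf ->.
  by rewrite mul0r.
rewrite big_nat_recr //= -IHt mulrBr !mulr_suml -sumrB.
under eq_bigr do rewrite rmorphB /= mulrBl.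
rewrite !sumrB; congr (_ - _).
  rewrite (reindex_inj (addIr (t.+1 * m.+1)%:R)) /=.
  by apply: eq_bigr => j _; rewrite addrK xi_powD // mulrA.
rewrite (reindex_inj (addIr (t.+1 * m)%:R)) /=.
by apply: eq_bigr => j _; rewrite addrK xi_powD // mulrA.
Qed.

Lemma prime_odd_half : p = (m + m).+1.
Proof. by rewrite -prime_half_double // prednK ?prime_gt0. Qed.

Lemma prime_mod4 : (p == 1 %[mod 4])%N = ~~ odd p.-1./2.
Proof.
have pE := prime_odd_half; have := odd_double_half p.-1./2.
set m := p.-1./2 in pE *; rewrite -muln2; case: (odd m) => /= mE.
  by apply/negP => /eqP; rewrite pE; lia.
by apply/eqP; rewrite pE; lia.
Qed.

(** The factorization of (X^p - 1)/(X - 1), evaluated at 1. *)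
Lemma prod_1_sub_xi : \prod_(1 <= k < p) (1 - xi R p ^+ k) = p%:R.
Proof.
have X1 : 'X - 1 != 0 :> {poly C} by rewrite -polyC1 polyXsubC_eq0.
have := factor_Xn_sub_1 (xi_primitive R p_prime p_odd).
rewrite big_ltn ?prime_gt0 // expr0 subrX1 polyC1 => /(mulfI X1).
move/(congr1 (fun q => q.[1])); rewrite horner_prod horner_sum.
under eq_bigr do rewrite !hornerE.
move=> ->; under eq_bigr do rewrite hornerXn expr1n.
by rewrite sumr_const card_ord.
Qed.

(** The k-th factor has squared modulus (1 - xi^k)(1 - xi^(p-k)), so pairing k with p - k yields the
    product of all 1 - xi^k. *)
Lemma half_product_norm :
  `|\prod_(1 <= k < m.+1) (chi (k * m.+1)%:R - chi (k * m)%:R)| ^+ 2 = p%:R :> C.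
Proof.
rewrite normCK rmorph_prod -big_split /= -prod_1_sub_xi.
rewrite [in RHS]prime_odd_half big_nat_fold_half -prime_odd_half.
apply: eq_big_nat => k /andP[k0 km].
have kp : (k <= p)%N by have := prime_odd_half; lia.
rewrite -!xi_pow_nat // rmorphB /= !conj_xi_pow // natrB // pchar_Fp_0 // sub0r.
have -> : (k * m.+1)%:R = (k * m)%:R + k%:R :> 'F_p by rewrite -natrD mulnS addnC.
rewrite !opprD !xi_powD //; have := xi_powNM R p_prime (k * m)%:R.
set x := chi (- (k * m)%:R); set y := chi (k * m)%:R; set u := chi k%:R; set v := chi (- k%:R) => xy.
by transitivity ((x * y) * ((1 - u) * (1 - v))); [ring | rewrite xy mul1r].
Qed.

(** The exponents come from halving: m + 1 = (p + 1)/2 and m = (p - 1)/2, so the angles are pi k +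
    pi k/p and pi k - pi k/p, and the difference of the two roots of unity is (-1)^k i times 2
    sin(pi k/p). Sines at these arguments are nonnegative, which fixes the sign of the product. *)
Lemma half_product_polar :
  \prod_(1 <= k < m.+1) (chi (k * m.+1)%:R - chi (k * m)%:R)
  = \prod_(1 <= k < m.+1) ((-1) ^+ k * 'i%C)
    * (\prod_(1 <= k < m.+1) (2 * sin (pi * k%:R / p%:R) : R))%:C%C.
Proof.
rewrite rmorph_prod -big_split /=; apply: eq_bigr => k _.
have p0 := p_neq0 R p_prime.
rewrite !xi_pow_nat // -[xi R p]/(cis _) !cisX.
have mR : m%:R = (p%:R - 1) / 2 :> R.
  have := congr1 (fun k => k%:R : R) prime_odd_half; rewrite -natr1 natrD; lra.
have e1 : 2 * pi / p%:R *+ (k * m.+1) = pi *+ k + pi * k%:R / p%:R :> R.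
  by rewrite -(mulr_natr pi k) -(mulr_natr (2 * pi / p%:R)) natrM -[m.+1%:R]natr1 mR; field.
have e2 : 2 * pi / p%:R *+ (k * m) = pi *+ k - pi * k%:R / p%:R :> R.
  by rewrite -(mulr_natr pi k) -(mulr_natr (2 * pi / p%:R)) natrM mR; field.
rewrite e1 e2 !cisD -cisX cis_pi -mulrBr -[RHS]mulrA; congr (_ * _).
rewrite /cis cosN sinN; apply/eqP; rewrite eq_complex /=.
by rewrite !(mul0r, mulr0, mul1r, subrr, opprK, oppr0, add0r) mulr_natl mulr2n !eqxx.
Qed.

Lemma sqrt_p_half_product :
  \prod_(1 <= k < m.+1) (2 * sin (pi * k%:R / p%:R) : R) = Num.sqrt p%:R.
Proof.
set Q := (X in X = _).
have Q0 : 0 <= Q.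
  rewrite /Q big_nat; apply: prodr_ge0 => k /andP[k0 km].
  have p0 : 0 < p%:R :> R by rewrite ltr0n prime_gt0.
  have kp : k%:R <= p%:R :> R by rewrite ler_nat; have := prime_odd_half; lia.
  have pi0 := pi_ge0 R.
  rewrite mulr_ge0 // sin_ge0_pi //; apply/andP; split.
    by rewrite divr_ge0 ?mulr_ge0 // ltW.
  by rewrite ler_pdivrMr // ler_wpM2l.
suff Q2 : Q ^+ 2 = p%:R by rewrite -Q2 sqrtr_sqr ger0_norm.
have := half_product_norm; rewrite half_product_polar -/Q normrM normr_prod big1 => [|k _].
  rewrite mul1r ger0_norm ?ler0c // -rmorphXn -(rmorph_nat (real_complex R)).
  exact: complexI.
by rewrite normrM normrX normrN1 expr1n mul1r normc_def /= expr0n expr1n add0r sqrtr1.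
Qed.

Lemma sign_i_prod t :
  (-1) ^+ t * \prod_(1 <= k < t.+1) ((-1) ^+ k * 'i%C) = (if odd t then 'i%C else 1) :> C.
Proof.
elim: t => [|t IHt]; first by rewrite big_geq // mul1r.
rewrite big_nat_recr //= exprS [-1 * _]mulrC mulrACA IHt mulrN1 mulN1r mulNr opprK -signr_odd.
case: (odd t); rewrite ?expr1 ?expr0 ?mul1r //=.
by rewrite mulN1r mulrN -expr2 sqr_i opprK.
Qed.

Theorem gauss_value : gauss = (if odd m then 'i%C else 1) * (Num.sqrt (p%:R : R))%:C%C.
Proof.
pose P : C := \sum_j (half_product m j)%:~R * chi j.
have PE : P = \prod_(1 <= k < m.+1) ((-1) ^+ k * 'i%C) * (Num.sqrt p%:R)%:C%C.
  by rewrite /P half_product_sum half_product_polar sqrt_p_half_product.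
suff [s [gs s1]] : exists s : int, gauss = s%:~R * P /\ s = (-1) ^+ m.
  by rewrite gs PE mulrA s1 rmorphXn rmorphN1 /= sign_i_prod.
have : gauss ^+ 2 = P ^+ 2.
  rewrite gauss_sqr qcharN1 // PE exprMn -!rmorphXn sqr_sqrtr ?ler0n // rmorph_nat; congr (_ * _).
  rewrite -prodrXl; under eq_bigr do rewrite exprMn sqr_i -exprM muln2 -signr_odd odd_double mul1r.
  by rewrite prodr_const_nat subSS subn0 rmorphXn rmorphN1.
move/eqP; rewrite eqf_sqr => gP.
have [s gs s2] : exists2 s : int, gauss = s%:~R * P & `|s| = 1.
  by case/orP: gP => /eqP ->; [exists 1 | exists (-1)]; rewrite ?mul1r ?mulN1r.
exists s; split=> //.
(* [gauss] and s P are equal complex numbers, so their coefficients agree up to a constant. *)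
have cst : forall i j : 'F_p, qchar i - s * half_product m i = qchar j - s * half_product m j.
  apply: (xi_pow_relation p_prime p_odd (R := R) (a := fun j => qchar j - s * half_product m j)).
  under eq_bigr do rewrite rmorphB rmorphM mulrBl /=.
  rewrite sumrB -/gauss_sum gs /P mulr_sumr; apply/eqP; rewrite subr_eq0; apply/eqP.
  by apply: eq_bigr => j _; rewrite mulrA.
apply: (Fp_int_small_inj p_prime p_odd).
  by rewrite -signr_odd; case: (odd m); rewrite ?expr1 ?expr0; lia.
(* The m-th moment of a constant vanishes because m < p - 1. That of [qchar] is the sum of all
   j^(p-1), namely -1, and that of [half_product] is -(-1)^m; this determines s modulo p. *)
have /eqP : \sum_j (qchar j - s * half_product m j)%:~R * j ^+ m = 0 :> 'F_p.
  under eq_bigr do rewrite (cst _ 0).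
  by rewrite -mulr_sumr Fp_sum_exp ?mulr0 //; have := prime_half_double p_prime p_odd; have := prime_half_gt0 p_prime p_odd; lia.
under eq_bigr do rewrite rmorphB rmorphM mulrBl /=.
rewrite sumrB.
under eq_bigr do rewrite qchar_Fp // -exprD -prime_half_double //.
rewrite Fp_sum_exp_pred //.
under eq_bigr do rewrite -mulrA.
rewrite -mulr_sumr; have := moment_half_product p_prime p_odd (leqnn m).
rewrite /moment eqxx half_factorial_sqr // => ->.
rewrite mulrN opprK addrC subr_eq0 => /eqP sm.
rewrite rmorphXn rmorphN1 /=; apply: (mulIf (negbT (signr_eq0 _ m))).
by rewrite sm -expr2 sqrr_sign.
Qed.

End GaussSum.

(** * Walsh coefficients of bent functions *)

Section CyclotomicIntegers.
Variables (R : realType) (p : nat).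
Hypotheses (p_prime : prime p) (p_odd : odd p).
Local Notation C := (R[i]).
Local Notation chi := (@xi_pow R p).
Local Notation m := (p.-1./2).
Local Notation gauss := (gauss_sum R p).

(** Since p divides the norm, the autocorrelation of a is constant modulo p, so the moments of a
    below m vanish. The correlations B k of a with [qchar] are then all congruent to the m-th
    moment. They are the coefficients of z times the conjugate Gauss sum; subtracting B 0 makes them
    divisible by p, and the Gauss sum times its conjugate is p. *)
Lemma cyclotomic_gauss_dvd (a : 'F_p -> int) l :
  (\sum_j (a j)%:~R * chi j) * (\sum_j (a j)%:~R * chi j)^*%R = (p ^ l.+1)%:R ->
  exists b : 'F_p -> int, \sum_j (a j)%:~R * chi j = gauss * \sum_j (b j)%:~R * chi j.
Proof.
set z := \sum_j _ => zz.
pose A (k : 'F_p) : int := \sum_j a (j + k) * a j - (if k == 0 then (p ^ l.+1)%:Z else 0).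
have cstA : forall i j, A i = A j.
  apply: (xi_pow_relation p_prime p_odd (R := R) (a := A)).
  under eq_bigr do rewrite rmorphB mulrBl.
  rewrite sumrB -sum_xi_pow_conjM // zz (bigD1 0) //= xi_pow0 mulr1 big1 ?addr0 ?subrr //.
  by move=> j /negPf ->; rewrite mul0r.
have autocor (k : 'F_p) : \sum_j (a (j + k))%:~R * (a j)%:~R = (A 0)%:~R :> 'F_p.
  rewrite -(cstA k) /A rmorphB rmorph_sum /=.
  have -> : (if k == 0 then (p ^ l.+1)%:Z else 0)%:~R = 0 :> 'F_p.
    by case: ifP => // _; apply/eqP; rewrite Fp_int_eq0 // dvdzE expnS dvdn_mulr.
  by rewrite subr0; apply: eq_bigr => j _; rewrite rmorphM.
have mom0 := moment_autocorrelation p_prime p_odd (a := fun j => (a j)%:~R) autocor.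
pose B (k : 'F_p) : int := \sum_j a (j + k) * qchar j.
have Bmod k : (p%:Z %| (B k - B 0)%R)%Z.
  rewrite -Fp_int_eq0 // rmorphB subr_eq0 /=; apply/eqP.
  have BE i : (B i)%:~R = moment (fun j => (a j)%:~R) m :> 'F_p.
    rewrite -(moment_cross_correlation p_prime p_odd i mom0) rmorph_sum.
    by apply: eq_bigr => j _; rewrite rmorphM /= qchar_Fp.
  by rewrite !BE.
exists (fun k => ((B k - B 0)%R %/ p%:Z)%Z).
set w := \sum_j _.
have zg : z * gauss^*%R = p%:R * w.
  transitivity (\sum_k (B k - B 0)%:~R * chi k).
    under [RHS]eq_bigr do rewrite rmorphB mulrBl.
    by rewrite sumrB -mulr_sumr sum_xi_pow // mulr0 subr0 sum_xi_pow_conjM.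
  rewrite mulr_sumr; apply: eq_bigr => k _.
  rewrite mulrA -[p%:R]/(p%:Z%:~R) -rmorphM /=; congr (_%:~R * _).
  by rewrite mulrC divzK.
have p0 : p%:R != 0 :> C by rewrite pnatr_eq0 gtn_eqF ?prime_gt0.
apply: (mulfI p0); rewrite mulrCA -zg mulrCA gauss_norm // mulrC //.
Qed.

Lemma int_sum_sqr_eq1 (I : finType) (a : I -> int) :
  \sum_i a i * a i = 1 -> exists i, (a i = 1 \/ a i = -1) /\ forall j, j != i -> a j = 0.
Proof.
move=> a1.
have /existsP[i ai] : [exists i, a i != 0].
  apply: contra_eqT a1; rewrite negb_exists => /forallP a0.
  by rewrite big1 // => i _; have := a0 i; rewrite negbK => /eqP ->.
exists i; move: a1; rewrite (bigD1 i) //= => a1.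
have rest0 : 0 <= \sum_(j | j != i) a j * a j by apply: sumr_ge0 => j _; rewrite -expr2 sqr_ge0.
have rest1 : \sum_(j | j != i) a j * a j = 0.
  have ai1 : 1 <= a i * a i.
    have : 0 < a i * a i by rewrite -expr2 lt0r sqrf_eq0 ai sqr_ge0.
    by [].
  by apply: le_anti; rewrite rest0 andbT -(lerD2l (a i * a i)) a1 addr0.
split=> [|j ji].
  move: a1; rewrite rest1 addr0 => /eqP; rewrite -expr2 sqrf_eq1.
  by case/orP => /eqP; [left | right].
have /psumr_eq0P/(_ rest1 j ji)/eqP : forall j, j != i -> 0 <= a j * a j.
  by move=> k _; rewrite -expr2 sqr_ge0.
by rewrite -expr2 sqrf_eq0 => /eqP.
Qed.

(** Comparing coefficients gives sum a_j^2 = 1 + c and (sum a_j)^2 = 1 + p c. Hence sum a_j is 1 or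
    -1 modulo p, and subtracting a constant from all coefficients, which leaves the value unchanged,
    makes it exactly 1 or -1. Then c = 0, so the squares sum to 1 and a single coefficient
    remains. *)
Lemma cyclotomic_unit_norm (a : 'F_p -> int) :
  (\sum_j (a j)%:~R * chi j) * (\sum_j (a j)%:~R * chi j)^*%R = 1 ->
  exists j, \sum_j (a j)%:~R * chi j = chi j \/ \sum_j (a j)%:~R * chi j = - chi j.
Proof.
have autocor (b : 'F_p -> int) :
    (\sum_j (b j)%:~R * chi j) * (\sum_j (b j)%:~R * chi j)^*%R = 1 ->
    exists c : int, \sum_j b j * b j = 1 + c /\ (\sum_j b j) ^+ 2 = 1 + p%:Z * c.
  rewrite sum_xi_pow_conjM // => b1.
  pose A (k : 'F_p) : int := \sum_j b (j + k) * b j - (if k == 0 then 1 else 0).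
  have cstA : forall i j, A i = A j.
    apply: (xi_pow_relation p_prime p_odd (R := R) (a := A)).
    under eq_bigr do rewrite rmorphB mulrBl.
    rewrite sumrB b1 (bigD1 0) //= xi_pow0 mulr1 big1 ?addr0 ?subrr //.
    by move=> j /negPf ->; rewrite mul0r.
  exists (A 0); split.
    by rewrite /A eqxx addrC subrK; apply: eq_bigr => j _; rewrite addr0.
  have : \sum_k A k = p%:Z * A 0.
    by under eq_bigr do rewrite (cstA _ 0); rewrite sumr_const cardT -cardE card_Fp // -mulr_natl natz.
  have -> : \sum_k A k = \sum_k (\sum_j b (j + k) * b j) - 1.
    rewrite sumrB; congr (_ - _).
    by rewrite (bigD1 0) //= big1 ?addr0 // => k /negPf ->.
  move=> /eqP; rewrite subr_eq addrC => /eqP <-.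
  rewrite exchange_big expr2 mulr_sumr; apply: eq_bigr => j _ /=.
  by rewrite -mulr_suml; congr (_ * _); rewrite [LHS](reindex_inj (addrI j)).
move=> a1; have [c [_ ac]] := autocor a a1.
have [e e1 [t at_]] : exists2 e : int, e * e = 1 & exists t : int, \sum_j a j = e + p%:Z * t.
  have pF : (p%:Z)%:~R = 0 :> 'F_p by exact: pchar_Fp_0.
  have : (\sum_j a j)%:~R ^+ 2 = 1 :> 'F_p.
    by rewrite -rmorphXn ac rmorphD rmorphM /= pF mul0r addr0.
  have sol (e : int) : (\sum_j a j)%:~R = e%:~R :> 'F_p ->
      exists t : int, \sum_j a j = e + p%:Z * t.
    move=> ae; have : (p%:Z %| (\sum_j a j - e)%R)%Z by rewrite -Fp_int_eq0 // rmorphB /= ae subrr.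
    by case/dvdzP => t /eqP; rewrite subr_eq => /eqP ->; exists t; rewrite addrC mulrC.
  move/eqP; rewrite sqrf_eq1 => /orP[/eqP|/eqP] aS; [exists 1 => // | exists (-1) => //].
    by apply: sol; rewrite aS.
  by apply: sol; rewrite aS rmorphN1.
pose b j := a j - t.
have bz : \sum_j (b j)%:~R * chi j = \sum_j (a j)%:~R * chi j.
  under eq_bigr do rewrite rmorphB mulrBl.
  by rewrite sumrB -mulr_sumr sum_xi_pow // mulr0 subr0.
have sumb : \sum_j b j = e.
  by rewrite sumrB at_ sumr_const cardT -cardE card_Fp // -mulr_natl natz addrK.
have [c' [b1]] : exists c : int, \sum_j b j * b j = 1 + c /\ (\sum_j b j) ^+ 2 = 1 + p%:Z * c.
  by apply: autocor; rewrite bz.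
rewrite sumb expr2 e1 => /eqP; rewrite eq_sym -subr_eq0 addrC addKr mulf_eq0.
rewrite eqz_nat gtn_eqF ?prime_gt0 //= => /eqP c0.
have [i [bi b0]] : exists i, (b i = 1 \/ b i = -1) /\ forall j, j != i -> b j = 0.
  by apply: int_sum_sqr_eq1; rewrite b1 c0 addr0.
exists i; rewrite -bz (bigD1 i) //= big1 => [|j /b0 ->]; last by rewrite mul0r.
by rewrite addr0; case: bi => ->; [left; rewrite mul1r | right; rewrite mulN1r].
Qed.

(* Kumar, Scholtz and Welch: a Walsh coefficient of absolute value [p^(l/2)]
   is divisible by [gauss^l], and the quotient is a unit of absolute value 1. *)
Lemma cyclotomic_norm_pX (a : 'F_p -> int) l :
  (\sum_j (a j)%:~R * chi j) * (\sum_j (a j)%:~R * chi j)^*%R = (p ^ l)%:R ->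
  exists j, \sum_j (a j)%:~R * chi j = gauss ^+ l * chi j
         \/ \sum_j (a j)%:~R * chi j = - (gauss ^+ l * chi j).
Proof.
elim: l a => [|l IHl] a aa.
  by have [j] := cyclotomic_unit_norm aa; exists j; rewrite expr0 mul1r.
have [b ab] := cyclotomic_gauss_dvd aa.
have p0 : p%:R != 0 :> C by rewrite pnatr_eq0 gtn_eqF ?prime_gt0.
have [|j bj] := IHl b.
  apply: (mulfI p0); rewrite -natrM -expnS -aa ab rmorphM mulrACA gauss_norm //.
exists j; rewrite ab exprS -!mulrA -mulrN.
by case: bj => ->; [left | right].
Qed.

End CyclotomicIntegers.

(** * The constant G, its integer coefficients and its conjugates *)

Section BentWalsh.
Variables (R : realType) (p n : nat).
Hypotheses (p_prime : prime p) (p_odd : odd p) (n_odd : odd n).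
Local Notation C := (R[i]).
Local Notation chi := (@xi_pow R p).
Local Notation gauss := (gauss_sum R p).
Local Notation G := (mu R p n * root_pn R p n).
Implicit Types (f : 'rV['F_p]_n -> 'F_p) (al : 'rV['F_p]_n).

Lemma prime_exp_odd_mod4 : (p ^ n = p %[mod 4])%N.
Proof.
have p2 : (p ^ 2 = 1 %[mod 4])%N.
  have pE := prime_odd_half p_prime p_odd; set m := p.-1./2 in pE.
  have -> : (p ^ 2 = (m * m + m) * 4 + 1)%N by rewrite pE; ring.
  by rewrite modnMDl.
rewrite -[in LHS](odd_double_half n) n_odd expnD expn1 -mul2n expnM -modnMm -modnXm p2.
by rewrite modnXm exp1n modnMmr modnMml muln1.
Qed.

(** The sign of the Gauss sum enters here: mu is the same fourth root of unity as the one in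
    [gauss_value], because p^n = p modulo 4. *)
Lemma mu_root_pn : G = (p ^ n./2)%:R * gauss.
Proof.
rewrite gauss_value // /root_pn /mu prime_exp_odd_mod4 (prime_mod4 p_prime p_odd) if_neg mulrCA; congr (_ * _).
rewrite -[X in _ ^+ X](odd_double_half n) n_odd exprD expr1 -muln2 exprM.
rewrite mulrC sqrtrM ?exprn_ge0 // sqrtr_sqr ger0_norm ?exprn_ge0 // -natrX rmorphM.
by rewrite rmorph_nat.
Qed.

Lemma mu_root_pn_gauss : G = gauss ^+ n \/ G = - gauss ^+ n.
Proof.
have -> : gauss ^+ n = ((qchar (-1 : 'F_p)) ^+ n./2 * (p ^ n./2)%N%:Z)%:~R * gauss.
  by rewrite -gauss_exp_odd //; congr (_ ^+ _); rewrite -[LHS]odd_double_half n_odd.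
rewrite mu_root_pn qcharN1 // -exprM -signr_odd rmorphM /= -mulrA.
by case: (odd _); [right; rewrite mulN1r opprK | left; rewrite mul1r].
Qed.

Lemma root_pn_sqr : root_pn R p n ^+ 2 = (p ^ n)%:R.
Proof. by rewrite -rmorphXn sqr_sqrtr ?exprn_ge0 // -natrX rmorph_nat. Qed.

Lemma walsh_fibres f al :
  walsh R f al = \sum_j (\sum_(x | f x - dot al x == j) 1 : int)%:~R * chi j.
Proof.
rewrite -(sum_xi_pow_fibres xpredT (fun=> 1) (fun x => f x - dot al x)).
by apply: eq_bigr => x _; rewrite mul1r.
Qed.

Lemma bent_walsh f al : bent R f ->
  exists j, walsh R f al = G * chi j \/ walsh R f al = - (G * chi j).
Proof.
move=> /(_ al)/(congr1 (fun z => z ^+ 2)); rewrite root_pn_sqr normCK walsh_fibres.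
case/(cyclotomic_norm_pX p_prime p_odd) => j Wj; exists j; move: Wj.
by case: mu_root_pn_gauss => -> [] ->; rewrite ?mulNr ?opprK; [left|right|right|left].
Qed.

Lemma mu_root_pn_neq0 : G != 0.
Proof.
rewrite mu_root_pn mulf_neq0 ?gauss_neq0 // pnatr_eq0 -lt0n expn_gt0 prime_gt0 //.
Qed.

Lemma conj_mu_root_pn : G^*%R = (qchar (-1 : 'F_p))%:~R * G.
Proof. by rewrite mu_root_pn rmorphM /= rmorph_nat gauss_conj // mulrCA. Qed.

Lemma mu_root_pn_norm : G * G^*%R = (p ^ n)%:R.
Proof.
rewrite mu_root_pn rmorphM /= rmorph_nat mulrACA gauss_norm // -!natrM -expnD -expnSr.
by congr (_ ^ _)%:R; rewrite addnn -[RHS]odd_double_half n_odd.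
Qed.

(** The coefficient of xi^j in G xi^b is p^((n-1)/2) qchar(j - b), so a sum with value e G xi^b has
    its fibre sums prescribed up to a constant. *)
Lemma mu_root_pn_relation (I : finType) (P : pred I) (c : I -> int) (u : I -> 'F_p) (e : int) b :
  \sum_(i | P i) (c i)%:~R * chi (u i) = e%:~R * (G * chi b) ->
  forall j k, \sum_(i | P i && (u i == j)) c i - e * (p ^ n./2)%N%:Z * qchar (j - b)
            = \sum_(i | P i && (u i == k)) c i - e * (p ^ n./2)%N%:Z * qchar (k - b).
Proof.
move=> rel; apply: (xi_pow_relation p_prime p_odd (R := R)
  (a := fun j => \sum_(i | P i && (u i == j)) c i - e * (p ^ n./2)%N%:Z * qchar (j - b))).
under eq_bigr do rewrite rmorphB mulrBl.
rewrite sumrB -(sum_xi_pow_fibres P c u) rel mu_root_pn; apply/eqP; rewrite subr_eq0; apply/eqP.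
rewrite [RHS](reindex_inj (addIr b)) /= /gauss_sum mulr_sumr mulr_suml mulr_sumr.
apply: eq_bigr => j _; rewrite addrK !rmorphM /= xi_powD // !mulrA.
by congr (_ * _ * _ * _).
Qed.

(** This is the Galois conjugation xi -> xi^y: the coefficients are known up to a constant, the
    constant drops out of the new sum, and twisting the Gauss sum by y produces the factor qchar
    y. *)
Lemma mu_root_pn_scale y : y != 0 -> forall (I : finType) (P : pred I) (c : I -> int) (u : I -> 'F_p) (e : int) b,
  \sum_(i | P i) (c i)%:~R * chi (u i) = e%:~R * (G * chi b) ->
  \sum_(i | P i) (c i)%:~R * chi (y * u i) = (e * qchar y)%:~R * (G * chi (y * b)).
Proof.
move=> y0 I P c u e b rel; have cst := mu_root_pn_relation rel.
set q := e * _ in cst; pose A j := \sum_(i | P i && (u i == j)) c i.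
have AE j : A j = A 0 - q * qchar (0 - b) + q * qchar (j - b) by rewrite -(cst j) subrK.
rewrite (sum_xi_pow_fibres P c u (fun j => chi (y * j))).
under eq_bigr do rewrite -/(A _) AE rmorphD mulrDl /=.
rewrite big_split /= -mulr_sumr sum_xi_pow_scale // (negPf y0) mulr0 add0r.
rewrite (reindex_inj (addIr b)) /=.
under eq_bigr do rewrite addrK rmorphM /= mulrDr xi_powD // -mulrA [X in _ * X]mulrA.
rewrite -mulr_sumr -mulr_suml gauss_twist // mu_root_pn /q !rmorphM /= !mulrA.
by congr (_ * _); rewrite -!mulrA; congr (_ * _); exact: mulrCA.
Qed.

Lemma mu_root_pn_parity (I : finType) (P : pred I) (c : I -> int) (u : I -> 'F_p) (e1 e2 : int) a b :
  e1 = 1 \/ e1 = -1 -> e2 = 1 \/ e2 = -1 ->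
  2 * (\sum_(i | P i) (c i)%:~R * chi (u i)) = e1%:~R * (G * chi a) + e2%:~R * (G * chi b) ->
  a = b.
Proof.
move=> e1P e2P rel; apply: contra_eq (erefl true) => ab.
pose A j : int := \sum_(i | P i && (u i == j)) c i.
pose q : int := (p ^ n./2)%N.
have cst := xi_pow_relation p_prime p_odd (R := R)
  (a := fun j => 2 * A j - q * (e1 * qchar (j - a) + e2 * qchar (j - b))).
have ab0 : a - b != 0 by rewrite subr_eq0.
(* If a != b, the points j = a and j = 2a - b separate parities: at the first one of the two
   characters vanishes, leaving a single sign; at the second both are nonzero, leaving a sum of two
   signs. With p^((n-1)/2) odd, the two coefficients cannot be equal. *)
have /cst/(_ a (a + (a - b))) : \sum_j (2 * A j - q * (e1 * qchar (j - a) + e2 * qchar (j - b)))%:~R * chi j = 0.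
  have shift e d : e%:~R * (G * chi d) = \sum_j (q * (e * qchar (j - d)))%:~R * chi j.
    rewrite [RHS](reindex_inj (addIr d)) /= mu_root_pn /gauss_sum mulr_sumr mulr_suml mulr_sumr.
    apply: eq_bigr => j _; rewrite addrK !rmorphM /= xi_powD // !mulrA.
    by congr (_ * _ * _ * _); rewrite mulrC.
  apply/eqP; rewrite -[X in _ == X](subrr (e1%:~R * (G * chi a) + e2%:~R * (G * chi b))) -{1}rel.
  rewrite !shift (sum_xi_pow_fibres P c u) mulr_sumr -big_split -sumrB; apply/eqP/eq_bigr => j _ /=.
  by rewrite -mulrDl mulrA -mulrBl mulrDr rmorphB rmorphD rmorphM.
rewrite subrr qchar0 addrAC subrr add0r.
have -> : a + (a - b) - b = 2%:R * (a - b) by rewrite mulr_natl mulr2n addrAC.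
have q1 : odd `|q|%N by rewrite /q /= oddX p_odd orbT.
have s1 := qchar_pm1 ab0.
have s2 : qchar (2%:R * (a - b)) = 1 \/ qchar (2%:R * (a - b)) = -1.
  by apply: qchar_pm1; rewrite mulf_neq0 // Fp_two_neq0.
move: (A a) (A (a + (a - b))) (qchar _) (qchar _) s1 s2 => x y s t.
by case: e1P e2P => -> [] -> [] -> [] ->; lia.
Qed.
End BentWalsh.

Lemma is_partitionP (T : finType) (k : nat) (U : k.-tuple {set T}) :
  reflect [/\ forall i, exists x, x \in tnth U i,
              forall x, exists i, x \in tnth U i &
              forall i j x, x \in tnth U i -> x \in tnth U j -> i = j]
          (is_partition U).
Proof.
apply: (iffP andP) => [[uU /and3P[/eqP cov /trivIsetP triv U0]]|[ne cov inj]].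
  split=> [i|x|i j x xi xj].
  - apply/set0Pn; apply: contraNneq U0 => <-; by rewrite inE mem_tnth.
  - have : x \in cover [set A in U] by rewrite cov inE.
    by case/bigcupP => A; rewrite inE => /tnthP[i ->] xA; exists i.
  - apply/eqP; rewrite -(inj_eq (tuple_uniqP U uU)).
    apply: contraLR xj => /(triv _ _ _ _); rewrite !inE !mem_tnth.
    by move=> /(_ isT isT)/disjointFr -> //.
split.
  apply/tuple_uniqP => i j Uij; have [x xi] := ne i.
  by apply: (inj _ _ x) => //; rewrite -Uij.
apply/and3P; split.
- rewrite eqEsubset subsetT; apply/subsetP => x _; have [i xi] := cov x.
  by apply/bigcupP; exists (tnth U i); rewrite ?inE ?mem_tnth.
- apply/trivIsetP => A B; rewrite !inE => /tnthP[i ->] /tnthP[j ->] ij.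
  apply/pred0P => x /=; apply: contraNF ij => /andP[xi xj].
  by rewrite (inj _ _ _ xi xj).
- by rewrite inE; apply/negP => /tnthP[i U0]; have [x] := ne i; rewrite -U0 inE.
Qed.

(** * Fourier transform and translation schemes *)

Section Dot.
Variables (p n : nat).
Implicit Types x y z : 'rV['F_p]_n.

Lemma dotC x y : dot x y = dot y x.
Proof. by apply: eq_bigr => i _; rewrite mulrC. Qed.

Lemma dotDr x y z : dot x (y + z) = dot x y + dot x z.
Proof. by rewrite -big_split; apply: eq_bigr => i _; rewrite mxE mulrDr. Qed.

Lemma dotZr a x y : dot x (a *: y) = a * dot x y.
Proof. by rewrite /dot mulr_sumr; apply: eq_bigr => i _; rewrite mxE mulrCA. Qed.

Lemma dotDl x y z : dot (y + z) x = dot y x + dot z x.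
Proof. by rewrite dotC dotDr !(dotC x). Qed.

Lemma dotZl a x y : dot (a *: y) x = a * dot y x.
Proof. by rewrite dotC dotZr (dotC x). Qed.

Lemma dotNr x y : dot x (- y) = - dot x y.
Proof. by rewrite -scaleN1r dotZr mulN1r. Qed.

Lemma dot0r x : dot x 0 = 0.
Proof. by rewrite -(scale0r 0) dotZr mul0r. Qed.

Lemma dot0l x : dot 0 x = 0.
Proof. by rewrite dotC dot0r. Qed.

Lemma dot_eq0 x : (forall y, dot x y = 0) -> x = 0.
Proof.
move=> x0; apply/rowP => i; rewrite mxE -[RHS](x0 (delta_mx 0 i)) /dot (bigD1 i) //= big1.
  by rewrite mxE !eqxx mulr1 addr0.
by move=> j /negPf ji; rewrite mxE ji andbF mulr0.
Qed.

End Dot.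

Section Fourier.
Variables (R : realType) (p n : nat).
Hypotheses (p_prime : prime p) (p_odd : odd p).
Local Notation C := (R[i]).
Local Notation chi := (@xi_pow R p).
Local Notation V := ('rV['F_p]_n).
Implicit Types (x y al be : V) (S : {set V}) (phi : V -> C).

Definition fourier phi al : C := \sum_x phi x * chi (- dot al x).

Definition set_fourier S al : C := \sum_(x in S) chi (- dot al x).

Lemma set_fourierE S al : set_fourier S al = fourier (fun x => (x \in S)%:R) al.
Proof.
by rewrite /set_fourier big_mkcond; apply: eq_bigr => x _; case: ifP; rewrite ?mul1r ?mul0r.
Qed.

Lemma sum_subgroup_char S al : 0 \in S -> (forall x y, y \in S -> (x + y \in S) = (x \in S)) ->
  \sum_(x in S) chi (dot al x) = if al \in dot_perp S then #|S|%:R else 0.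
Proof.
move=> S0 SD; rewrite inE; case: ifP => [/forall_inP aS|/negbT/forall_inPn[y yS ay]].
  under eq_bigr => x xS do rewrite (eqP (aS x xS)) xi_pow0.
  by rewrite sumr_const.
have y1 : chi (dot al y) - 1 != 0.
  by rewrite subr_eq0 xi_pow_eq1.
apply: (mulfI y1); rewrite mulr0 mulrBl mul1r mulr_sumr; apply/eqP; rewrite subr_eq0; apply/eqP.
rewrite [RHS](reindex_inj (addIr y)) /=; apply: eq_big => x; first by rewrite SD.
by move=> _; rewrite dotDr xi_powD // mulrC.
Qed.

Lemma dot_perpT : dot_perp [set: V] = [set 0].
Proof.
apply/setP => x; rewrite !inE; apply/forall_inP/eqP => [x0|-> y _]; last by rewrite dot0l.
by apply: dot_eq0 => y; apply/eqP/x0.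
Qed.

Lemma sum_char al : \sum_x chi (dot al x) = if al == 0 then (p ^ n)%:R else 0.
Proof.
have := @sum_subgroup_char [set: V] al (in_setT _); rewrite dot_perpT inE cardsT card_mx card_Fp //.
rewrite mul1n => <- => [|x y _]; last by rewrite !inE.
by apply: eq_bigl => x; rewrite inE.
Qed.

Lemma fourier_inversion phi y : \sum_al fourier phi al * chi (dot al y) = (p ^ n)%:R * phi y.
Proof.
under eq_bigr do rewrite mulr_suml; rewrite exchange_big /=.
rewrite (bigD1 y) //= [X in _ + X]big1 ?addr0 => [|x xy].
  under eq_bigr do rewrite -mulrA xi_powNM // mulr1.
  by rewrite sumr_const cardT -cardE card_mx card_Fp // mul1n mulr_natl.
under eq_bigr do rewrite -mulrA -xi_powD // -dotNr -dotDr dotC.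
by rewrite -mulr_sumr sum_char addrC subr_eq0 eq_sym (negPf xy) mulr0.
Qed.

Lemma pn_neq0 : (p ^ n)%:R != 0 :> C.
Proof. by rewrite pnatr_eq0 -lt0n expn_gt0 prime_gt0. Qed.

Lemma fourier_inj phi psi : fourier phi =1 fourier psi -> phi =1 psi.
Proof.
move=> pp y; apply: (mulfI pn_neq0); rewrite -!fourier_inversion.
by apply: eq_bigr => al _; rewrite pp.
Qed.

Lemma fourier_convolution S (T : {set V}) al :
  fourier (fun t => #|[set s | (t - s \in S) && (s \in T)]|%:R) al
  = set_fourier S al * set_fourier T al.
Proof.
rewrite /fourier /set_fourier mulr_sumr.
transitivity (\sum_t \sum_(s in T) (t - s \in S)%:R * chi (- dot al t)).
  apply: eq_bigr => t _; rewrite -mulr_suml; congr (_ * _).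
  rewrite -sum1_card natr_sum [RHS]big_mkcond [LHS]big_mkcond; apply: eq_bigr => s _.
  by rewrite inE; case: (s \in T); rewrite ?andbF ?andbT //; case: ifP.
rewrite exchange_big; apply: eq_bigr => s _ /=.
rewrite (reindex_inj (addIr s)) /= mulr_suml [RHS]big_mkcond; apply: eq_bigr => t _.
by rewrite addrK; case: ifP; rewrite ?mul0r // mul1r dotDr opprD xi_powD.
Qed.

Lemma fourier_lin (I : finType) (c : I -> C) (S : I -> {set V}) al :
  fourier (fun x => \sum_i c i * (x \in S i)%:R) al = \sum_i c i * set_fourier (S i) al.
Proof.
rewrite /fourier; under eq_bigr do rewrite mulr_suml.
rewrite exchange_big; apply: eq_bigr => i _ /=.
by rewrite set_fourierE /fourier mulr_sumr; apply: eq_bigr => x _; rewrite mulrA.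
Qed.

(* Bridges--Mena: when the Fourier transforms of the [d.+1] blocks are constant
   on the fibres of a map to [d.+1] points, they span all functions of that map,
   a space closed under products, so the span of the blocks is closed under
   convolution. *)
Lemma fourier_scheme d (U : d.+1.-tuple {set V}) (w : V -> 'I_d.+1) :
  is_partition U -> tnth U ord0 = [set 0] ->
  (forall i x, x \in tnth U i -> - x \in tnth U i) ->
  (forall i al be, w al = w be -> set_fourier (tnth U i) al = set_fourier (tnth U i) be) ->
  induces_symmetric_scheme U.
Proof.
move=> partU U0 UN Uw; have /is_partitionP[ne cov inj] := partU.
(* The default 0 stands for labels with an empty fibre; [repE] only evaluates [rep] at labels that
   are attained. *)
pose rep j := odflt 0 [pick al | w al == j].
have repE i al : set_fourier (tnth U i) (rep (w al)) = set_fourier (tnth U i) al.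
  by apply: Uw; rewrite /rep; case: pickP => [be /eqP //|/(_ al)]; rewrite eqxx.
pose P : 'M[C]_d.+1 := \matrix_(i, j) set_fourier (tnth U i) (rep j).
have sumU (c : 'I_d.+1 -> C) j x : x \in tnth U j -> \sum_i c i * (x \in tnth U i)%:R = c j.
  move=> xj; rewrite (bigD1 j) //= xj mulr1 big1 ?addr0 // => i ij.
  by case: (boolP (x \in _)) => [xi|_]; rewrite ?mulr0 //; rewrite (inj _ _ _ xi xj) eqxx in ij.
(* A row vector killed by P is a combination of block indicators whose Fourier transform vanishes
   everywhere; by inversion the combination is zero, and the blocks are nonempty and disjoint. *)
have unitP : P \in unitmx.
  rewrite -row_free_unit -kermx_eq0; apply/eqP/row_matrixP => k; rewrite row0.
  set v := row k _; have vP : v *m P = 0 by rewrite -row_mul mulmx_ker row0.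
  apply/rowP => j; rewrite [RHS]mxE; have [x xj] := ne j.
  rewrite -[LHS](sumU (fun i => v 0 i) j x xj).
  rewrite (@fourier_inj (fun x => \sum_i v 0 i * (x \in tnth U i)%:R) (fun=> 0)) // => al.
  rewrite fourier_lin [RHS]big1 => [|y _]; last by rewrite mul0r.
  have := congr1 (fun M : 'rV_d.+1 => M 0 (w al)) vP; rewrite mxE [RHS]mxE => vPw; rewrite -[RHS]vPw.
  by apply: eq_bigr => i _; rewrite [P _ _]mxE repE.
have conv u v : exists c : 'I_d.+1 -> C, forall t,
    #|[set s | (t - s \in tnth U u) && (s \in tnth U v)]|%:R = \sum_i c i * (t \in tnth U i)%:R.
  (* The transform of the convolution is the product of the two rows of P; solving against P
     expresses it through the transforms of the blocks. *)
  pose r := \row_j (P u j * P v j); exists (fun i => (r *m invmx P) 0 i).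
  apply: fourier_inj => al; rewrite fourier_convolution fourier_lin.
  have := congr1 (fun M : 'rV_d.+1 => M 0 (w al)) (mulmxKV unitP r); rewrite mxE [RHS]mxE !mxE !repE => <-.
  by apply: eq_bigr => i _; rewrite [P _ _]mxE repE.
have symU i : transpose_rel (tnth [tuple of map (@difference_rel p n) U] i)
              = tnth [tuple of map (@difference_rel p n) U] i.
  apply/setP => -[x y]; rewrite tnth_map !inE /=.
  by apply/idP/idP => /UN; rewrite opprB.
split=> //; split=> //; split.
- by apply/card_gt0P; exists 0.
- apply/is_partitionP; split=> [i|[x y]|i j [x y]].
  + by have [x xi] := ne i; exists (x, 0); rewrite tnth_map inE subr0.
  + by have [i xi] := cov (x - y); exists i; rewrite tnth_map inE.
  + by rewrite !tnth_map !inE; exact: inj.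
- by apply/setP => -[x y]; rewrite tnth_map U0 !inE /= subr_eq0.
- by move=> j; exists j; exact: symU.
move=> u v k; have [c cE] := conv u v; have [t0 t0k] := ne k.
exists #|[set s | (t0 - s \in tnth U u) && (s \in tnth U v)]| => x y.
rewrite !tnth_map inE /= => xyk.
apply/eqP; rewrite -(eqr_nat C) cE (sumU c k _ t0k) -(sumU c k _ xyk) -cE eqr_nat.
rewrite -(card_imset _ (addIr (- y))); apply/eqP/eq_card => s.
apply/imsetP/idP => [[z]|].
  by rewrite !inE /= => /andP[zu zv] ->; rewrite zv andbT; rewrite opprB addrA addrNK.
rewrite !inE => /andP[su sv]; exists (s + y); rewrite ?addrK // !inE /=.
by rewrite addrK sv andbT opprD addrA [x - s - y]addrAC su.
Qed.

End Fourier.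

(** * Association schemes from a pair of dual functions *)

Definition subspace_set (p n : nat) (S : {set 'rV['F_p]_n}) : Prop :=
  [/\ 0 \in S, forall x y, y \in S -> (x + y \in S) = (x \in S) &
      forall a x, x \in S -> a *: x \in S].

(** * Subspaces, their orthogonals and their Fourier transforms *)

Section SubspaceSets.
Variables (R : realType) (p n : nat).
Hypotheses (p_prime : prime p) (p_odd : odd p).
Local Notation V := 'rV['F_p]_n.
Implicit Types (x y : V) (S : {set V}).

Lemma is_subspace_of_dim_set r S : is_subspace_of_dim r S -> subspace_set S.
Proof.
case=> W [-> _]; split=> [|x y|a x]; rewrite !inE ?mem0v //; first by move=> yW; rewrite rpredDr.
exact: rpredZ.
Qed.

Lemma card_is_subspace_of_dim r S : is_subspace_of_dim r S -> #|S| = (p ^ r)%N.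
Proof.
case=> W [-> <-]; transitivity (#|'F_p| ^ \dim W)%N; last by rewrite card_Fp.
by rewrite -card_vspace; apply: eq_card => x; rewrite inE.
Qed.

Lemma subspace_setN S x : subspace_set S -> (- x \in S) = (x \in S).
Proof.
case=> _ _ SZ; apply/idP/idP => /(SZ (-1)); rewrite scaleN1r ?opprK //.
Qed.

Lemma subspace_setZ S a x : subspace_set S -> a != 0 -> (a *: x \in S) = (x \in S).
Proof.
case=> _ _ SZ a0; apply/idP/idP => [/(SZ a^-1)|/(SZ a)//].
by rewrite scalerA mulVf // scale1r.
Qed.

Lemma dot_perp_subspace S : subspace_set (dot_perp S).
Proof.
split=> [|x y|a x]; rewrite !inE.
- by apply/forall_inP => y _; rewrite dot0l.
- move/forall_inP => yS; apply: eq_forallb_in => z zS.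
  by rewrite dotDl (eqP (yS z zS)) addr0.
- by move/forall_inP => xS; apply/forall_inP => z zS; rewrite dotZl (eqP (xS z zS)) mulr0.
Qed.

Lemma set_fourier_subspace S al : subspace_set S ->
  set_fourier R S al = if al \in dot_perp S then #|S|%:R else 0.
Proof.
move=> subS; have [S0 SD _] := subS; rewrite -(sum_subgroup_char R p_prime p_odd al S0 SD).
rewrite /set_fourier [LHS](reindex_inj oppr_inj) /=.
apply: eq_big => x; first by rewrite subspace_setN.
by rewrite dotNr opprK.
Qed.

(** Fourier inversion at 0 for the indicator of S, whose transform is #|S| on the orthogonal and 0
    elsewhere. *)
Lemma card_dot_perp S : subspace_set S -> (#|S| * #|dot_perp S|)%N = (p ^ n)%N.
Proof.
move=> subS; have [S0 _ _] := subS; apply/eqP; rewrite -(eqr_nat R[i]) natrM.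
have := fourier_inversion p_prime p_odd (fun x => (x \in S)%:R : R[i]) 0.
rewrite S0 mulr1 => <-; rewrite eq_sym (bigID (mem (dot_perp S))) /= [X in _ + X]big1 ?addr0.
  under eq_bigr => al alS.
    rewrite dot0r xi_pow0 mulr1 -set_fourierE set_fourier_subspace // alS.
    over.
  by rewrite sumr_const mulr_natr.
by move=> al /negPf alS; rewrite -set_fourierE set_fourier_subspace // alS mul0r.
Qed.

Lemma dot_perpK S : subspace_set S -> dot_perp (dot_perp S) = S.
Proof.
move=> subS; apply/esym/eqP; rewrite eqEcard; apply/andP; split.
  apply/subsetP => x xS; rewrite inE; apply/forall_inP => y; rewrite inE => /forall_inP/(_ x xS).
  by rewrite dotC.
have c1 := card_dot_perp subS; have c2 := card_dot_perp (dot_perp_subspace S).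
have : (0 < #|S| * #|dot_perp S|)%N by rewrite c1 expn_gt0 prime_gt0.
by rewrite muln_gt0 => /andP[_ p0]; rewrite -(leq_pmul2l p0) c2 mulnC c1.
Qed.

(** As p is odd, x -> -x fixes only 0; T picks from each pair the member of smaller enumeration
    rank. *)
Lemma card_even_oppr_invariant S : 0 \notin S -> (forall x, x \in S -> - x \in S) -> ~~ odd #|S|.
Proof.
move=> S0 SN; pose T := [set x in S | (enum_rank x < enum_rank (- x))%N].
have TS : [set - x | x in T] = S :\: T.
  apply/setP => x; apply/imsetP/idP => [[y]|].
    rewrite !inE => /andP[yS yy] ->; rewrite opprK (SN y yS) andbT /=.
    by rewrite -leqNgt ltnW.
  rewrite !inE => /andP[xT xS]; exists (- x); rewrite ?opprK // !inE opprK SN //=.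
  move: xT; rewrite xS /= -leqNgt leq_eqVlt => /orP[/eqP|//] /ord_inj/enum_rank_inj xx.
  case/negP: S0; suff -> : 0 = x by [].
  apply/eqP; rewrite eq_sym; have : 2%:R *: x == 0 by rewrite scaler_nat mulr2n -{1}xx addNr.
  by rewrite scaler_eq0 (negPf (Fp_two_neq0 p_prime p_odd)).
have TsubS : T \subset S by apply/subsetP => x; rewrite inE => /andP[].
rewrite -(cardsID T S) (setIidPr TsubS) -TS card_imset; last exact: oppr_inj.
by rewrite addnn odd_double.
Qed.

Lemma set_fourierD (A B : {set V}) al : B \subset A ->
  set_fourier R (A :\: B) al = set_fourier R A al - set_fourier R B al.
Proof.
move=> BA; apply/eqP; rewrite eq_sym subr_eq addrC /set_fourier.
rewrite (big_setID B) /= (setIidPr BA) //.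
Qed.

Lemma set_fourier0 (al : V) : set_fourier R ([set 0] : {set V}) al = 1.
Proof. by rewrite /set_fourier big_set1 dot0r oppr0 xi_pow0. Qed.

End SubspaceSets.

Lemma is_partition_label (T : finType) (k : nat) (U : k.-tuple {set T}) (u : T -> 'I_k) :
  (forall i, exists x, x \in tnth U i) -> (forall i x, (x \in tnth U i) = (u x == i)) ->
  is_partition U.
Proof.
move=> ne Uu; apply/is_partitionP; split=> // [x|i j x].
  by exists (u x); rewrite Uu.
by rewrite !Uu => /eqP <- /eqP.
Qed.

Lemma fourier_scheme_label (R : realType) (p n d : nat) (U : d.+1.-tuple {set 'rV['F_p]_n})
    (u w : 'rV['F_p]_n -> nat) :
  prime p -> odd p -> (forall x, (u x < d.+1)%N) -> (forall al, (w al < d.+1)%N) ->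
  tnth U ord0 = [set 0] -> (forall i, exists x, x \in tnth U i) ->
  (forall i x, (x \in tnth U i) = (u x == i)) ->
  (forall i x, (- x \in tnth U i) = (x \in tnth U i)) ->
  (forall i al be, w al = w be ->
     set_fourier R (tnth U i) al = set_fourier R (tnth U i) be) ->
  induces_symmetric_scheme U.
Proof.
move=> p_prime p_odd ud wd U0 ne uU UN wU.
apply: (@fourier_scheme R p n p_prime p_odd d U (fun al => Ordinal (wd al))) => //.
- by apply: (@is_partition_label _ _ _ (fun x => Ordinal (ud x))) => // i x; rewrite uU.
- by move=> i x; rewrite UN.
- by move=> i al be /(congr1 val) /=; exact: wU.
Qed.

(* [sign_index] numbers the values 0, 1, -1 of [qchar]. [block5] and [block7]
   give the position of the block containing a point in the tuples of [scheme5]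
   and [scheme7]; [dual_block5] and [dual_block7] label frequencies in such a way
   that the Fourier transform of every block is a function of the label. *)
Section PieceLabels.
Variables (p n : nat).
Hypotheses (p_prime : prime p) (p_odd : odd p).
Local Notation V := 'rV['F_p]_n.
Local Notation q := (qchar (-1 : 'F_p)).
Variables (f g : V -> 'F_p) (D E : {set V}).
Implicit Types (x al be : V).
Local Notation Cpiece s := [set x in ~: D | qchar (f x) == s].
Local Notation Dpiece s := [set x in D | qchar (f x) == s].

Lemma q_pm1 : q = 1 \/ q = -1.
Proof. by apply: qchar_pm1; rewrite oppr_eq0 oner_eq0. Qed.

Definition same_class al be :=
  [/\ (al == 0) = (be == 0), (al \in dot_perp D) = (be \in dot_perp D),
      (al \in E) = (be \in E) & qchar (g al) = qchar (g be)].

Definition sign_index (s : int) : nat := if s == 0 then 0 else if s == 1 then 1 else 2.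

Lemma sign_index_lt s : (sign_index s < 3)%N.
Proof. by rewrite /sign_index; case: (s == 0) => //; case: (s == 1). Qed.

Lemma sign_index_inj (a b : 'F_p) :
  sign_index (qchar a) = sign_index (qchar b) -> qchar a = qchar b.
Proof.
have v (c : 'F_p) : [\/ qchar c = 0, qchar c = 1 | qchar c = -1].
  by have [->|/qchar_pm1[]] := eqVneq c 0; [apply: Or31; exact: qchar0 | apply: Or32 | apply: Or33].
by case: (v a) (v b) => -> [] ->.
Qed.

Lemma pieceN (A : {set V}) s x : subspace_set A -> (forall x, f (- x) = f x) ->
  (- x \in [set x in A | qchar (f x) == s]) = (x \in [set x in A | qchar (f x) == s]).
Proof. by move=> subA fN; rewrite !in_set subspace_setN // fN. Qed.

Lemma CpieceN s x : subspace_set D -> (forall x, f (- x) = f x) ->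
  (- x \in [set x in ~: D | qchar (f x) == s]) = (x \in [set x in ~: D | qchar (f x) == s]).
Proof. by move=> subD fN; rewrite !in_set subspace_setN // fN. Qed.

Lemma same_class_by_cases al be :
  (forall al, al \in dot_perp D -> al \in E /\ g al = 0) ->
  (al == 0) = (be == 0) -> (al \in dot_perp D) = (be \in dot_perp D) ->
  (al \notin dot_perp D -> be \notin dot_perp D ->
     (al \in E) = (be \in E) /\ qchar (g al) = qchar (g be)) -> same_class al be.
Proof.
move=> g_perpD ab0 abD; case: (boolP (al \in dot_perp D)) => alD.
  have beD : be \in dot_perp D by rewrite -abD.
  by have [[aE ga] [bE gb]] := (g_perpD _ alD, g_perpD _ beD); split; rewrite // ?aE ?bE // ga gb.
by move=> /(_ isT); rewrite -abD => /(_ alD)[abE abg].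
Qed.

Lemma qchar_f_cases x : [\/ qchar (f x) = 0, qchar (f x) = 1 | qchar (f x) = -1].
Proof.
by have [->|/qchar_pm1[]] := eqVneq (f x) 0; [apply: Or31; exact: qchar0 | apply: Or32 | apply: Or33].
Qed.

Definition block5 x : nat :=
  if x == 0 then 0 else if x \notin D then (sign_index (qchar (f x))).+1
  else if qchar (f x) == 0 then 4 else 5.

Definition block7 x : nat :=
  if x == 0 then 0 else if x \notin D then (sign_index (qchar (f x))).+1
  else if x \in dot_perp E then 4 else 5 + sign_index (qchar (f x)).

Definition dual_block5 al : nat :=
  if al == 0 then 0 else if al \in dot_perp D then 1 else if al \in E then 2
  else (sign_index (qchar (g al))).+3.

Definition dual_block7 al : nat :=
  if al == 0 then 0 else if al \in dot_perp D then 1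
  else (if al \in E then 2 else 5) + sign_index (qchar (g al)).

Lemma block5_lt x : (block5 x < 6)%N.
Proof.
by rewrite /block5; do ![case: ifP => // _]; have := sign_index_lt (qchar (f x)); lia.
Qed.

Lemma block7_lt x : (block7 x < 8)%N.
Proof.
by rewrite /block7; do ![case: ifP => // _]; have := sign_index_lt (qchar (f x)); lia.
Qed.

Lemma dual_block5_lt al : (dual_block5 al < 6)%N.
Proof.
by rewrite /dual_block5; do ![case: ifP => // _]; have := sign_index_lt (qchar (g al)); lia.
Qed.

Lemma dual_block7_lt al : (dual_block7 al < 8)%N.
Proof.
by rewrite /dual_block7; do ![case: ifP => // _]; have := sign_index_lt (qchar (g al)); lia.
Qed.

Lemma perpD0 : 0 \in dot_perp D.
Proof. by have [] := dot_perp_subspace D. Qed.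

Lemma dual_label5_inj (a0 aD aE b0 bD bE : bool) (s t : nat) :
  (a0 -> aD) -> (b0 -> bD) ->
  (if a0 then 0 else if aD then 1 else if aE then 2 else s.+3)%N
  = (if b0 then 0 else if bD then 1 else if bE then 2 else t.+3)%N ->
  [/\ a0 = b0, aD = bD & ~~ aD -> aE = bE /\ (~~ aE -> s = t)].
Proof.
case: a0 aD aE b0 bD bE => [] [] [] [] [] [] aP bP st.
all: first [by have := aP isT | by have := bP isT | discriminate st
           | by split=> // _; split=> // _; case: st].
Qed.

Lemma dual_label7_inj (a0 aD aE b0 bD bE : bool) (s t : nat) :
  (s < 3)%N -> (t < 3)%N -> (a0 -> aD) -> (b0 -> bD) ->
  (if a0 then 0 else if aD then 1 else (if aE then 2 else 5) + s)%N
  = (if b0 then 0 else if bD then 1 else (if bE then 2 else 5) + t)%N ->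
  [/\ a0 = b0, aD = bD & ~~ aD -> aE = bE /\ s = t].
Proof.
case: s t => [|[|[|//]]] [|[|[|//]]] _ _.
all: case: a0 aD aE b0 bD bE => [] [] [] [] [] [] aP bP st.
all: first [discriminate st | by have := aP isT | by have := bP isT | by split].
Qed.

Lemma perpD_eq0 al : al == 0 -> al \in dot_perp D.
Proof. by move/eqP->; exact: perpD0. Qed.

(** [dual_block5] gives one label to all of E outside the orthogonal of D; the second hypothesis
    says that nothing is lost by not recording the character of g there. *)
Lemma dual_block5_class al be :
  (forall al, al \in dot_perp D -> al \in E /\ g al = 0) ->
  (al \in E -> al \notin dot_perp D -> be \in E -> be \notin dot_perp D ->
     qchar (g al) = qchar (g be)) ->
  dual_block5 al = dual_block5 be -> same_class al be.
Proof.
move=> g_perpD line /(dual_label5_inj (@perpD_eq0 al) (@perpD_eq0 be))[w0 wD wE].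
apply: (same_class_by_cases g_perpD w0 wD) => alD beD.
have [abE abg] := wE alD; split; first exact: abE.
case: (boolP (al \in E)) => alE; last exact: (sign_index_inj (abg alE)).
by apply: (line alE alD _ beD); rewrite -abE.
Qed.

Lemma dual_block7_class al be :
  (forall al, al \in dot_perp D -> al \in E /\ g al = 0) ->
  dual_block7 al = dual_block7 be -> same_class al be.
Proof.
move=> g_perpD /(dual_label7_inj (sign_index_lt _) (sign_index_lt _) (@perpD_eq0 al)
  (@perpD_eq0 be))[w0 wD wE].
apply: (same_class_by_cases g_perpD w0 wD) => alD beD.
by have [abE /sign_index_inj abg] := wE alD; split; [exact: abE | exact: abg].
Qed.

Lemma mem_block5 x : 0 \in D -> f 0 = 0 -> (x \in D -> qchar (f x) != q) ->
  [/\ (x \in [set 0]) = (block5 x == 0%N), (x \in Cpiece 0) = (block5 x == 1%N),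
      (x \in Cpiece 1) = (block5 x == 2%N), (x \in Cpiece (-1)) = (block5 x == 3%N) &
      (x \in Dpiece 0 :\ 0) = (block5 x == 4%N) /\ (x \in Dpiece (- q)) = (block5 x == 5%N)].
Proof.
move=> D0 f0 qx.
rewrite in_setD1 !in_set in_set1 /block5; have [->|_] := eqVneq x 0.
  by rewrite D0 f0 qchar0; case: q_pm1 => ->.
case: (boolP (x \in D)) qx => _ qx; last by case: (qchar_f_cases x) => ->.
by case: q_pm1 (qx isT) => ->; case: (qchar_f_cases x) => ->.
Qed.

Lemma mem_block7 x : 0 \in D -> f 0 = 0 -> (x \in dot_perp E -> x \in D /\ f x = 0) ->
  [/\ (x \in [set 0]) = (block7 x == 0%N), (x \in Cpiece 0) = (block7 x == 1%N),
      (x \in Cpiece 1) = (block7 x == 2%N), (x \in Cpiece (-1)) = (block7 x == 3%N) &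
      [/\ (x \in dot_perp E :\ 0) = (block7 x == 4%N),
          (x \in Dpiece 0 :\: dot_perp E) = (block7 x == 5%N),
          (x \in Dpiece 1) = (block7 x == 6%N) & (x \in Dpiece (-1)) = (block7 x == 7%N)]].
Proof.
move=> D0 f0 xE; have perpE0 : 0 \in dot_perp E by have [] := dot_perp_subspace E.
rewrite /block7; move: (dot_perp E) xE perpE0 => P xE P0.
rewrite in_setD1 in_setD !in_set in_set1; have [->|_] := eqVneq x 0.
  by rewrite D0 f0 qchar0 P0.
case: (boolP (x \in P)) xE => [_ /(_ isT)[-> ->]|_ _]; first by rewrite qchar0.
by case: (x \in D); case: (qchar_f_cases x) => ->.
Qed.

End PieceLabels.

(* In the application [g] is the dual of [f], [D] is the minus set of [g], and
   [E] is the set of frequencies at which the exponential sum of [f] over [D]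
   does not vanish. *)
Section DualPair.
Variables (R : realType) (p n r h k : nat).
Hypotheses (p_prime : prime p) (p_odd : odd p) (n_odd : odd n).
Local Notation C := (R[i]).
Local Notation chi := (@xi_pow R p).
Local Notation V := 'rV['F_p]_n.
Local Notation G := (mu R p n * root_pn R p n).
Local Notation q := (qchar (-1 : 'F_p)).
Variables (f g : V -> 'F_p) (D E : {set V}).
Hypothesis f_homog : forall a x, a != 0 -> f (a *: x) = a ^+ h * f x.
Hypothesis g_homog : forall a x, a != 0 -> g (a *: x) = a ^+ k.+1 * g x.
(** The degrees of f and g are h and k + 1, and k is inverse to h - 1 modulo p - 1. *)
Hypothesis hk_inv : forall a : 'F_p, a != 0 -> a ^+ (h.-1 * k) = a.
Hypotheses (h_even : ~~ odd h) (k_odd : odd k) (f0 : f 0 = 0).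
Hypothesis sumD : forall al, \sum_(x in D) chi (f x - dot al x)
  = (if al \in E then - q else 0)%:~R * (G * chi (g al)).
Hypothesis sumC : forall al, \sum_(x in ~: D) chi (f x - dot al x)
  = (if al \in E then 0 else q)%:~R * (G * chi (g al)).
Hypothesis sumE : forall x, \sum_(al in E) chi (g al - dot x al)
  = (if x \in D then -1 else 0)%:~R * (G * chi (f x)).
Hypotheses (dimD : is_subspace_of_dim r D) (dimE : is_subspace_of_dim r E).

Let subD := is_subspace_of_dim_set dimD.
Let subE := is_subspace_of_dim_set dimE.
Let D0 : 0 \in D. Proof. by case: subD. Qed.
Let E0 : 0 \in E. Proof. by case: subE. Qed.

(** The sum over D does not see a shift by its orthogonal, and a nonzero value G xi^(g(al))
    determines both membership in E and the exponent. *)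
Lemma perpD_shift al de : al \in E -> de \in dot_perp D ->
  (al + de \in E) /\ g (al + de) = g al.
Proof.
move=> alE; rewrite inE => /forall_inP deD.
have : \sum_(x in D) chi (f x - dot (al + de) x) = \sum_(x in D) chi (f x - dot al x).
  by apply: eq_bigr => x xD; rewrite dotDl (eqP (deD x xD)) addr0.
rewrite !sumD alE; have qn : (- q)%:~R != 0 :> C by case: (q_pm1 p) => ->; rewrite intr_eq0.
have Gn := mu_root_pn_neq0 R p_prime p_odd n_odd.
case: ifP => _; first by move/(mulfI qn)/(mulfI Gn)/(xi_pow_inj p_prime p_odd).
rewrite mul0r => /esym/eqP; rewrite !mulf_eq0 (negPf qn) (negPf (xi_pow_neq0 _ _ _)) //.
by rewrite -mulf_eq0 (negPf Gn).
Qed.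

Lemma perpE_sub x : x \in dot_perp E -> x \in D /\ f x = 0.
Proof.
rewrite inE => /forall_inP xE.
have : \sum_(al in E) chi (g al - dot x al) = \sum_(al in E) chi (g al - dot 0 al).
  by apply: eq_bigr => al alE; rewrite (eqP (xE al alE)) dot0l.
rewrite !sumE D0 f0; have qn : (- 1)%:~R != 0 :> C by rewrite intr_eq0.
have Gn := mu_root_pn_neq0 R p_prime p_odd n_odd.
case: ifP => _; first by move/(mulfI qn)/(mulfI Gn)/(xi_pow_inj p_prime p_odd).
rewrite mul0r => /esym/eqP; rewrite !mulf_eq0 (negPf qn) (negPf (xi_pow_neq0 _ _ _)) //.
by rewrite -mulf_eq0 (negPf Gn).
Qed.

Lemma fN x : f (- x) = f x.
Proof.
rewrite -scaleN1r f_homog ?oppr_eq0 ?oner_eq0 // -signr_odd (negPf h_even) mul1r //.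
Qed.

(** The bracket is independent of j; summed over all j the character cancels and the fibres add up
    to S. *)
Lemma card_fibre_relation (S : {set V}) e b :
  \sum_(x in S) chi (f x) = e%:~R * (G * chi b) -> forall j,
  p%:Z * (#|[set x in S | f x == j]|%:Z - e * (p ^ n./2)%N%:Z * qchar (j - b)) = #|S|%:Z.
Proof.
move=> rel j.
have {}rel : \sum_(x | x \in S) (1 : int)%:~R * chi (f x) = e%:~R * (G * chi b).
  by rewrite -rel; apply: eq_bigr => x _; rewrite mul1r.
have cst := mu_root_pn_relation p_prime p_odd n_odd rel.
set B : 'F_p -> int := fun j => \sum_(x | (x \in S) && (f x == j)) 1 - e * (p ^ n./2)%N%:Z * qchar (j - b).
have BE i : #|[set x in S | f x == i]|%:Z - e * (p ^ n./2)%N%:Z * qchar (i - b) = B i.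
  rewrite /B -natz -sum1_card natr_sum; congr (_ - _); apply: eq_bigl => x.
  by rewrite inE.
have -> : p%:Z * (#|[set x in S | f x == j]|%:Z - e * (p ^ n./2)%N%:Z * qchar (j - b)) = \sum_i B i.
  rewrite BE; under eq_bigr do rewrite (cst _ j : B _ = B j).
  by rewrite sumr_const cardT -cardE card_Fp // -mulr_natl natz.
have qb : \sum_(i : 'F_p) qchar (i - b) = 0.
  by rewrite (reindex_inj (addIr b)) /=; under eq_bigr do rewrite addrK; rewrite sum_qchar.
rewrite sumrB -mulr_sumr qb mulr0 subr0 -(partition_big f xpredT) //=.
by rewrite -natz -sum1_card natr_sum.
Qed.

(** Counting shows that the fibre of f over g 0 in D has p^(r-1) elements, an odd number. If g 0
    were nonzero, this fibre would avoid 0 and be stable under negation, hence even. *)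
Lemma g0 : g 0 = 0.
Proof.
have rel := sumD 0.
have {rel}/card_fibre_relation/(_ (g 0)) : \sum_(x in D) chi (f x) = (- q)%:~R * (G * chi (g 0)).
  by rewrite E0 in rel; rewrite -rel; apply: eq_bigr => x _; rewrite dot0l subr0.
rewrite subrr qchar0 mulr0 subr0 (card_is_subspace_of_dim p_prime dimD) => cardM.
apply/eqP; apply: contraT => gn0.
suff : ~~ odd #|[set x in D | f x == g 0]|.
  have : odd (p * #|[set x in D | f x == g 0]|)%N.
    by case: cardM => ->; rewrite oddX p_odd orbT.
  by rewrite oddM p_odd /= => ->.
apply: (card_even_oppr_invariant p_prime p_odd).
  by rewrite inE f0 eq_sym (negPf gn0) andbF.
by move=> x; rewrite !inE subspace_setN // fN.
Qed.

Lemma card_D_fibre j :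
  p%:Z * (#|[set x in D | f x == j]|%:Z + q * (p ^ n./2)%N%:Z * qchar j) = (p ^ r)%N%:Z.
Proof.
have := sumD 0; rewrite E0 g0 => rel.
have /card_fibre_relation/(_ j) : \sum_(x in D) chi (f x) = (- q)%:~R * (G * chi 0).
  by rewrite -rel; apply: eq_bigr => x _; rewrite dot0l subr0.
by rewrite subr0 !mulNr opprK (card_is_subspace_of_dim p_prime dimD).
Qed.

(** Because 0 lies in E, the sum over the complement of D vanishes at 0, so f is equidistributed on
    that complement, which is nonempty. *)
Lemma card_C_fibre j : (r < n)%N -> [set x in ~: D | f x == j] != set0.
Proof.
move=> rn; have := sumC 0; rewrite E0 => rel.
have /card_fibre_relation/(_ j) : \sum_(x in ~: D) chi (f x) = 0%:~R * (G * chi (g 0)).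
  by rewrite -rel; apply: eq_bigr => x _; rewrite dot0l subr0.
rewrite !mul0r subr0; apply: contra_eq_neq => ->.
rewrite cards0 mulr0 eq_sym eqz_nat cardsCs setCK card_mx card_Fp // mul1n.
by rewrite (card_is_subspace_of_dim p_prime dimD) subn_eq0 -ltnNge ltn_exp2l ?prime_gt1.
Qed.

Lemma sum_sqr_class_invariant (Phi : 'F_p -> C) (c t : 'F_p) : c != 0 ->
  (forall y b : 'F_p, b != 0 -> Phi (y * b ^+ 2) = Phi y) ->
  \sum_(y : 'F_p | y != 0) Phi y * chi (y^-1 ^+ k * (c ^+ 2 * t))
  = \sum_(y : 'F_p | y != 0) Phi y * chi (y^-1 ^+ k * t).
Proof.
(* Chosen so that b^k = c: the substitution y -> y b^2 divides y^-k by c^2 and leaves [Phi]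
   unchanged. *)
move=> c0 Phi2; pose b := c ^+ h.-1.
have b0 : b != 0 by rewrite expf_neq0.
have bk : b ^+ k = c by rewrite -exprM hk_inv.
rewrite [LHS](reindex_inj (mulIf (expf_neq0 2 b0))) /=; apply: eq_big => y.
  by rewrite mulf_eq0 expf_eq0 (negPf b0) andbF orbF.
move=> y0; rewrite Phi2 //; congr (_ * chi _).
have -> : (y * b ^+ 2)^-1 ^+ k = y^-1 ^+ k * (c ^+ 2)^-1.
  by rewrite invfM exprMn [(b ^+ 2)^-1 ^+ k]exprVn [b ^+ 2 ^+ k]exprAC bk.
by rewrite -mulrA mulKf // expf_neq0.
Qed.

(** The condition on f x is expanded in additive characters xi^(y(f x - j)). The term y = 0 is the
    transform of A. For y != 0 the sum over A is the conjugate by y of the known sum at y^-1 al, and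
    y g(y^-1 al) = y^-k g(al) by homogeneity. *)
Lemma set_fourier_piece_expand (A : {set V}) (e : V -> int) (J : {set 'F_p}) al :
  (forall al, \sum_(x in A) chi (f x - dot al x) = (e al)%:~R * (G * chi (g al))) ->
  (forall a al, a != 0 -> e (a *: al) = e al) ->
  p%:R * set_fourier R [set x in A | f x \in J] al
  = #|J|%:R * set_fourier R A al
    + (e al)%:~R * G * \sum_(y : 'F_p | y != 0)
        ((\sum_(j in J) chi (- (y * j))) * (qchar y)%:~R) * chi (y^-1 ^+ k * g al).
Proof.
move=> sumA eZ.
transitivity (\sum_y (\sum_(j in J) chi (- (y * j))) * \sum_(x in A) chi (y * f x - dot al x)).
  transitivity (\sum_(j in J) \sum_(x in A) \sum_y chi (- dot al x) * chi ((f x - j) * y)).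
    rewrite mulr_sumr exchange_big /= [LHS]big_mkcond [RHS]big_mkcond; apply: eq_bigr => x _.
    rewrite inE; case: (x \in A) => //=.
    under [RHS]eq_bigr do rewrite -mulr_sumr sum_xi_pow_scale //.
    rewrite -mulr_sumr.
    have -> : \sum_(j in J) (if f x - j == 0 then p%:R else 0) = (if f x \in J then p%:R else 0) :> C.
      case: ifP => fJ.
        rewrite (bigD1 (f x)) //= subrr eqxx big1 ?addr0 // => j /andP[_ jf].
        by rewrite subr_eq0 eq_sym (negPf jf).
      rewrite big1 // => j jJ; rewrite subr_eq0; case: eqP => // fj.
      by rewrite fj jJ in fJ.
    by rewrite mulrC; case: ifP; rewrite ?mulr0.
  rewrite [RHS](eq_bigr _ (fun y _ => mulr_suml _ _ _ _)) [RHS]exchange_big; apply: eq_bigr => j _ /=.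
  under [RHS]eq_bigr do rewrite mulr_sumr; rewrite [RHS]exchange_big; apply: eq_bigr => x _ /=.
  apply: eq_bigr => y _; rewrite -!xi_powD //; congr chi; ring.
rewrite (bigD1 0) //=; congr (_ + _).
  congr (_ * _); last by apply: eq_bigr => x _; rewrite mul0r sub0r.
  by under eq_bigr do rewrite mul0r oppr0 xi_pow0; rewrite sumr_const.
rewrite mulr_sumr; apply: eq_bigr => y y0.
have rel : \sum_(x in A) (1 : int)%:~R * chi (f x - dot (y^-1 *: al) x)
           = (e al)%:~R * (G * chi (g (y^-1 *: al))).
  by rewrite -(eZ y^-1) ?invr_eq0 // -sumA; apply: eq_bigr => x _; rewrite mul1r.
have -> : \sum_(x in A) chi (y * f x - dot al x)
    = \sum_(x in A) (1 : int)%:~R * chi (y * (f x - dot (y^-1 *: al) x)).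
  apply: eq_bigr => x _.
  by rewrite mul1r dotZl mulrBr [y * (_ * _)]mulrA divff // mul1r.
rewrite (mu_root_pn_scale p_prime p_odd n_odd y0 rel) g_homog ?invr_eq0 //.
rewrite exprS !mulrA divff // mul1r rmorphM /=.
set u := \sum_(j in J) _; set v := chi _; move: ((e al)%:~R) ((qchar y)%:~R) (mu _ _ _) (root_pn _ _ _) u v.
by move=> ? ? ? ? ? ?; ring.
Qed.

(** Equal quadratic characters mean g(be) = c^2 g(al) for some c != 0, and the factor c^2 is
    absorbed by rescaling y by a square, under which J and the character are stable. *)
Lemma set_fourier_piece (A : {set V}) (e : V -> int) (J : {set 'F_p}) al be :
  (forall al, \sum_(x in A) chi (f x - dot al x) = (e al)%:~R * (G * chi (g al))) ->
  (forall a al, a != 0 -> e (a *: al) = e al) ->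
  (forall c j : 'F_p, c != 0 -> (c ^+ 2 * j \in J) = (j \in J)) ->
  set_fourier R A al = set_fourier R A be -> e al = e be -> qchar (g al) = qchar (g be) ->
  set_fourier R [set x in A | f x \in J] al = set_fourier R [set x in A | f x \in J] be.
Proof.
move=> sumA eZ J2 Aab eab gab.
have p0 : p%:R != 0 :> C by rewrite pnatr_eq0 gtn_eqF ?prime_gt0.
apply: (mulfI p0); rewrite !(set_fourier_piece_expand _ _ sumA eZ) Aab eab.
congr (_ + _ * _); have [c c0 ->] := Fp_sqr_class p_prime p_odd gab.
rewrite (@sum_sqr_class_invariant (fun y => (\sum_(j in J) chi (- (y * j))) * (qchar y)%:~R)) //.
move=> y b b0; rewrite qcharM // qchar_sqr // mulr1; congr (_ * _).
rewrite [RHS](reindex_inj (mulfI (expf_neq0 2 b0))) /=.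
by apply: eq_big => [j|j _]; [rewrite J2 | rewrite [in RHS]mulrA].
Qed.

Section SameClass.
Variables al be : V.
Hypothesis al_be : same_class g D E al be.

Lemma same_class_fourierD : set_fourier R D al = set_fourier R D be.
Proof. by case: al_be => _ dd _ _; rewrite !set_fourier_subspace // dd. Qed.

Lemma same_class_fourierC : set_fourier R (~: D) al = set_fourier R (~: D) be.
Proof.
rewrite -setTD !set_fourierD ?subsetT // same_class_fourierD; congr (_ - _).
have subT : subspace_set [set: V] by split=> *; rewrite ?inE.
by rewrite !set_fourier_subspace // dot_perpT !inE; case: al_be => -> _ _ _.
Qed.

Lemma sqr_class_set (s : int) (c j : 'F_p) : c != 0 ->
  (c ^+ 2 * j \in [set j | qchar j == s]) = (j \in [set j | qchar j == s]).
Proof. by move=> c0; rewrite !inE qcharM // qchar_sqr // mul1r. Qed.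

Lemma same_class_fourier_Dpiece s :
  set_fourier R [set x in D | qchar (f x) == s] al = set_fourier R [set x in D | qchar (f x) == s] be.
Proof.
have eqS : [set x in D | qchar (f x) == s] = [set x in D | f x \in [set j | qchar j == s]].
  by apply/setP => x; rewrite !inE.
rewrite eqS; apply: (set_fourier_piece sumD) => [a ga a0|c j|||].
- by rewrite subspace_setZ.
- exact: sqr_class_set.
- exact: same_class_fourierD.
- by case: al_be => _ _ -> _.
- by case: al_be.
Qed.

Lemma same_class_fourier_Cpiece s :
  set_fourier R [set x in ~: D | qchar (f x) == s] al = set_fourier R [set x in ~: D | qchar (f x) == s] be.
Proof.
have eqS : [set x in ~: D | qchar (f x) == s] = [set x in ~: D | f x \in [set j | qchar j == s]].
  by apply/setP => x; rewrite !inE.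
rewrite eqS; apply: (set_fourier_piece sumC) => [a ga a0|c j|||].
- by rewrite subspace_setZ.
- exact: sqr_class_set.
- exact: same_class_fourierC.
- by case: al_be => _ _ -> _.
- by case: al_be.
Qed.

Lemma same_class_fourier_perpE : set_fourier R (dot_perp E) al = set_fourier R (dot_perp E) be.
Proof.
rewrite !set_fourier_subspace ?dot_perpK //; try exact: dot_perp_subspace.
by case: al_be => _ _ -> _.
Qed.

End SameClass.

Lemma g_perpD al : al \in dot_perp D -> al \in E /\ g al = 0.
Proof. by move=> alD; have := perpD_shift E0 alD; rewrite add0r g0. Qed.

(** A fibre in D has p^(r-1) - q qchar(j) p^((n-1)/2) elements, which is 0 only if the two powers
    coincide and the signs cancel. *)
Lemma card_D_fibre_eq0 j : [set x in D | f x == j] = set0 -> qchar j = q /\ r = n./2.+1.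
Proof.
move=> M0; have := card_D_fibre j; rewrite M0 cards0 add0r => eqp.
have pn0 : (0 < p ^ n./2)%N by rewrite expn_gt0 prime_gt0.
have pr0 : (0 < p ^ r)%N by rewrite expn_gt0 prime_gt0.
have p0 := prime_gt0 p_prime.
have j0 : j != 0.
  by apply/eqP => j0; move: eqp; rewrite j0 qchar0 !mulr0 => /eqP; rewrite eq_sym eqz_nat gtn_eqF.
have [|] : qchar j = q \/ qchar j = - q.
  by case: (qchar_pm1 j0) (q_pm1 p) => -> [] ->; [left|right|right|left].
  move=> jq; split=> //; move: eqp; rewrite jq mulrAC qchar_norm ?oppr_eq0 ?oner_eq0 // mul1r.
  by rewrite -PoszM -expnS => -[] /eqP; rewrite eqn_exp2l ?prime_gt1 // => /eqP.
move=> jq; move: eqp; rewrite jq mulrN mulrAC qchar_norm ?oppr_eq0 ?oner_eq0 // mul1r.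
by move: (p ^ _)%N pn0 (p ^ r)%N pr0 => u u0 v v0; nia.
Qed.

Lemma D_fibre_empty x : r = n./2.+1 -> x \in D -> qchar (f x) != q.
Proof.
move=> rE xD; apply/eqP => fq; have := card_D_fibre (f x).
rewrite fq mulrAC qchar_norm ?oppr_eq0 ?oner_eq0 // mul1r rE expnS PoszM.
have p0 : p%:Z != 0 by rewrite eqz_nat gtn_eqF ?prime_gt0.
move/(mulfI p0) => M0; have : (0 < #|[set y in D | f y == f x]|)%N.
  by apply/card_gt0P; exists x; rewrite inE xD eqxx.
by move: M0; lia.
Qed.

Lemma exists_Cpiece s (a : 'F_p) : (r < n)%N -> qchar a = s ->
  exists x, x \in [set x in ~: D | qchar (f x) == s].
Proof.
move=> rn <-; have /set0Pn[x] := card_C_fibre a rn.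
by rewrite !inE => /andP[xD /eqP fa]; exists x; rewrite !inE xD fa eqxx.
Qed.

Lemma exists_Dpiece s (a : 'F_p) : qchar a = s -> (qchar a = q -> r <> n./2.+1) ->
  exists x, x \in [set x in D | qchar (f x) == s].
Proof.
move=> <- aq; have : [set x in D | f x == a] != set0.
  by apply/eqP => /card_D_fibre_eq0[/aq].
case/set0Pn => x; rewrite !inE => /andP[xD /eqP fa]; exists x; by rewrite !inE xD fa eqxx.
Qed.

Lemma Dpiece0 : [set x in D | f x == 0] = [set x in D | qchar (f x) == 0].
Proof. by apply/setP => x; rewrite !inE qchar_eq0. Qed.

Lemma card_Dpiece0 : (p * #|[set x in D | qchar (f x) == 0]| = p ^ r)%N.
Proof. by have := card_D_fibre 0; rewrite qchar0 mulr0 addr0 Dpiece0 -PoszM => -[]. Qed.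

Lemma card_perpE : (p ^ r * #|dot_perp E| = p ^ n)%N.
Proof. by rewrite -(card_is_subspace_of_dim p_prime dimE) (card_dot_perp R). Qed.

Lemma card_perpD : (p ^ r * #|dot_perp D| = p ^ n)%N.
Proof. by rewrite -(card_is_subspace_of_dim p_prime dimD) (card_dot_perp R). Qed.

Lemma perpE_Dpiece0 : dot_perp E \subset [set x in D | qchar (f x) == 0].
Proof. by apply/subsetP => x /perpE_sub[xD fx]; rewrite inE xD fx qchar0 eqxx. Qed.

Lemma exists_neq0 (S : {set V}) : (1 < #|S|)%N -> exists x, x \in S :\ 0.
Proof.
move=> S1; apply/set0Pn; rewrite -card_gt0.
by move: S1; rewrite (cardsD1 0 S); case: (0 \in S) => //; exact: ltnW.
Qed.

Lemma perpE0 : 0 \in dot_perp E.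
Proof. by have [] := dot_perp_subspace E. Qed.

(** The orthogonal of D has dimension n - r = r - 1 and lies in E, so E is that orthogonal plus the
    line through al. Writing be = a al + de gives g(be) = a^(k+1) g(al), and k + 1 is even. *)
Lemma qchar_g_line al be : r = n./2.+1 ->
  al \in E -> al \notin dot_perp D -> be \in E -> be \notin dot_perp D -> qchar (g al) = qchar (g be).
Proof.
move=> rE alE alD beE beD.
have [perp0 perpA perpZ] := dot_perp_subspace D.
have [_ EA EZ] := subE.
pose F (u : 'F_p * V) := u.1 *: al + u.2.
have Finj : {in setX setT (dot_perp D) &, injective F}.
  move=> [a de] [b ep]; rewrite !in_setX /= => /andP[_ deD] /andP[_ epD]; rewrite /F /= => eqF.
  have abD : (a - b) *: al \in dot_perp D.
    have -> : (a - b) *: al = ep - de.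
      by apply/eqP; rewrite scalerBl subr_eq addrAC -subr_eq opprK eqF addrC.
    by rewrite perpA ?subspace_setN //; exact: dot_perp_subspace.
  have ab : a = b.
    apply/eqP; rewrite -subr_eq0; apply: contraNT alD => ab0.
    by rewrite -(subspace_setZ al (dot_perp_subspace D) ab0).
  by move: eqF; rewrite ab => /addrI ->.
have FE : F @: setX setT (dot_perp D) = E.
  apply/eqP; rewrite eqEcard card_in_imset // cardsX cardsT card_Fp //.
  apply/andP; split.
    apply/subsetP => y /imsetP[[a de]]; rewrite in_setX => /andP[_ /= deD] ->.
    by have [] := @perpD_shift (a *: al) de (EZ a _ alE) deD.
  have := card_perpD; rewrite (card_is_subspace_of_dim p_prime dimE) rE -[X in (_ * _ = p ^ X)%N](odd_double_half n) n_odd.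
  rewrite add1n -addnn -addSn expnD => /eqP; rewrite eqn_pmul2l ?expn_gt0 ?prime_gt0 // => /eqP ->.
  by rewrite -expnS.
move: beE; rewrite -FE => /imsetP[[a de]]; rewrite in_setX => /andP[_ /= deD] beF.
have a0 : a != 0.
  by apply: contraNneq beD => a0; rewrite beF /F a0 scale0r add0r.
have [_ gF] := perpD_shift (EZ a _ alE) deD.
by rewrite beF gF g_homog // qcharM // qcharX_even ?mul1r //= k_odd.
Qed.

Local Notation Cpiece s := [set x in ~: D | qchar (f x) == s].
Local Notation Dpiece s := [set x in D | qchar (f x) == s].

Lemma exists_sign (s : int) : s \in [:: 0; 1; -1] -> exists a : 'F_p, qchar a = s.
Proof.
rewrite !inE => /or3P[] /eqP ->; [exists 0; exact: qchar0 | exists 1; exact: qchar1 |].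
exact: exists_qcharN1.
Qed.

Lemma exists_Cpiece_sign s : (r < n)%N -> s \in [:: 0; 1; -1] -> exists x, x \in Cpiece s.
Proof. by move=> rn /exists_sign[a aE]; exact: exists_Cpiece rn aE. Qed.

(** On D the values of character q are not attained, so the only block of nonzero values has
    character - q: nonsquares when -1 is a square, squares otherwise. *)
Lemma scheme5 : r = n./2.+1 -> (3 <= n)%N ->
  @induces_symmetric_scheme p n 5
    [tuple [set 0]; Cpiece 0; Cpiece 1; Cpiece (-1); Dpiece 0 :\ 0; Dpiece (- q)].
Proof.
move=> rE n3; have n_half := odd_double_half n; rewrite n_odd in n_half.
have rn : (r < n)%N by rewrite rE; lia.
refine (@fourier_scheme_label R p n 5 _ (block5 f D) (dual_block5 g D E) p_prime p_odd
  (block5_lt p_prime p_odd f D) (dual_block5_lt p_prime p_odd g D E) _ _ _ _ _).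
- by rewrite (tnth_nth set0).
- case=> [[|[|[|[|[|[|//]]]]]] i6]; rewrite (tnth_nth set0) [nth _ _ _]/=.
  + by exists 0; rewrite inE.
  + exact: exists_Cpiece_sign.
  + exact: exists_Cpiece_sign.
  + exact: exists_Cpiece_sign.
  (* The zero fibre in D has p^(r-1) elements, and n >= 3 gives r >= 2. *)
  + apply: exists_neq0; rewrite -(ltn_pmul2l (prime_gt0 p_prime)) card_Dpiece0 muln1 rE.
    by rewrite -[X in (X < _)%N]expn1 ltn_exp2l; [lia | exact: prime_gt1].
  + have [a aq] : exists a : 'F_p, qchar a = - q.
      by apply: exists_sign; case: (q_pm1 p) => ->.
    by apply: (exists_Dpiece aq); rewrite aq; case: (q_pm1 p) => ->.
- move=> i x; have [m0 m1 m2 m3 [m4 m5]] := mem_block5 D0 f0 (D_fibre_empty rE (x := x)).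
  by case: i => [[|[|[|[|[|[|//]]]]]] i6]; rewrite (tnth_nth set0) [nth _ _ _]/=.
- case=> [[|[|[|[|[|[|//]]]]]] i6] x; rewrite (tnth_nth set0) [nth _ _ _]/=.
  + by rewrite !in_set1 oppr_eq0.
  + exact: CpieceN subD fN.
  + exact: CpieceN subD fN.
  + exact: CpieceN subD fN.
  + by rewrite !in_setD1 (pieceN _ _ subD fN) oppr_eq0.
  + exact: pieceN subD fN.
- move=> i al be /(dual_block5_class g_perpD (@qchar_g_line al be rE)) sab.
  case: i => [[|[|[|[|[|[|//]]]]]] i6]; rewrite (tnth_nth set0) [nth _ _ _]/=.
  + by rewrite !set_fourier0.
  + exact: same_class_fourier_Cpiece.
  + exact: same_class_fourier_Cpiece.
  + exact: same_class_fourier_Cpiece.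
  + have sub0 : [set 0] \subset Dpiece 0 by rewrite sub1set inE D0 f0 qchar0.
    by rewrite !(set_fourierD _ _ sub0) !set_fourier0 (same_class_fourier_Dpiece sab).
  + exact: same_class_fourier_Dpiece.
Qed.

Lemma scheme7 : (n./2.+1 < r < n)%N ->
  @induces_symmetric_scheme p n 7
    [tuple [set 0]; Cpiece 0; Cpiece 1; Cpiece (-1); dot_perp E :\ 0;
           Dpiece 0 :\: dot_perp E; Dpiece 1; Dpiece (-1)].
Proof.
case/andP=> r1 rn; have n_half := odd_double_half n; rewrite n_odd in n_half.
have p1 := prime_gt1 p_prime; have p0 := prime_gt0 p_prime.
have cE : #|dot_perp E| = (p ^ (n - r))%N.
  apply/eqP; rewrite -(@eqn_pmul2l (p ^ r)) ?expn_gt0 ?p0 // card_perpE -expnD.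
  by rewrite subnKC // ltnW.
refine (@fourier_scheme_label R p n 7 _ (block7 f D E) (dual_block7 g D E) p_prime p_odd
  (block7_lt p_prime p_odd f D E) (dual_block7_lt p_prime p_odd g D E) _ _ _ _ _).
- by rewrite (tnth_nth set0).
- case=> [[|[|[|[|[|[|[|[|//]]]]]]]] i8]; rewrite (tnth_nth set0) [nth _ _ _]/=.
  + by exists 0; rewrite inE.
  + exact: exists_Cpiece_sign.
  + exact: exists_Cpiece_sign.
  + exact: exists_Cpiece_sign.
  + by apply: exists_neq0; rewrite cE -[X in (X < _)%N](expn0 p) ltn_exp2l // subn_gt0.
  (* The sizes to compare are p^(r-1) and p^(n-r); the strict bound r > (n+1)/2 separates them. *)
  + apply/set0Pn; rewrite -card_gt0 -(ltn_pmul2l p0) muln0.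
    rewrite cardsD (setIidPr perpE_Dpiece0) mulnBr card_Dpiece0 cE -expnS subn_gt0.
    by rewrite ltn_exp2l //; lia.
  + have [a aq] : exists a : 'F_p, qchar a = 1 by exact: exists_sign.
    by apply: (exists_Dpiece aq) => _; lia.
  + have [a aq] : exists a : 'F_p, qchar a = -1 by exact: exists_sign.
    by apply: (exists_Dpiece aq) => _; lia.
- move=> i x; have [m0 m1 m2 m3 [m4 m5 m6 m7]] := mem_block7 D0 f0 (@perpE_sub x).
  by case: i => [[|[|[|[|[|[|[|[|//]]]]]]]] i8]; rewrite (tnth_nth set0) [nth _ _ _]/=.
- case=> [[|[|[|[|[|[|[|[|//]]]]]]]] i8] x; rewrite (tnth_nth set0) [nth _ _ _]/=.
  + by rewrite !in_set1 oppr_eq0.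
  + exact: CpieceN subD fN.
  + exact: CpieceN subD fN.
  + exact: CpieceN subD fN.
  + by rewrite !in_setD1 oppr_eq0 (subspace_setN _ (dot_perp_subspace E)).
  + by rewrite !in_setD (pieceN _ _ subD fN) (subspace_setN _ (dot_perp_subspace E)).
  + exact: pieceN subD fN.
  + exact: pieceN subD fN.
- move=> i al be /(dual_block7_class g_perpD) sab.
  case: i => [[|[|[|[|[|[|[|[|//]]]]]]]] i8]; rewrite (tnth_nth set0) [nth _ _ _]/=.
  + by rewrite !set_fourier0.
  + exact: same_class_fourier_Cpiece.
  + exact: same_class_fourier_Cpiece.
  + exact: same_class_fourier_Cpiece.
  + have sub0 : [set 0] \subset dot_perp E by rewrite sub1set perpE0.
    by rewrite !(set_fourierD _ _ sub0) !set_fourier0 (same_class_fourier_perpE sab).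
  + rewrite !(set_fourierD _ _ perpE_Dpiece0) (same_class_fourier_perpE sab).
    by rewrite (same_class_fourier_Dpiece sab).
  + exact: same_class_fourier_Dpiece.
  + exact: same_class_fourier_Dpiece.
Qed.

End DualPair.

(** * Duality of bent functions *)

Definition walsh_sign (R : realType) (p n : nat) (f : 'rV['F_p]_n -> 'F_p)
    (al : 'rV['F_p]_n) : int :=
  if al \in Bplus R f then 1 else -1.

Section BentDual.
Variables (R : realType) (p n : nat).
Hypotheses (p_prime : prime p) (p_odd : odd p) (n_odd : odd n).
Local Notation C := (R[i]).
Local Notation chi := (@xi_pow R p).
Local Notation V := 'rV['F_p]_n.
Local Notation G := (mu R p n * root_pn R p n).
Local Notation q := (qchar (-1 : 'F_p)).
Implicit Types (f : V -> 'F_p) (x al : V).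

(** Squaring removes the signs and gives 2a = 2b in F_p. *)
Lemma walsh_value_inj (e d : int) a b :
  e = 1 \/ e = -1 -> d = 1 \/ d = -1 ->
  e%:~R * (G * chi a) = d%:~R * (G * chi b) -> e = d /\ a = b.
Proof.
move=> eP dP; rewrite ![_%:~R * (G * _)]mulrCA => /(mulfI (mu_root_pn_neq0 R p_prime p_odd n_odd)) eq.
have ee : e%:~R ^+ 2 = 1 :> C by case: eP => ->; rewrite ?sqrrN expr1n.
have dd : d%:~R ^+ 2 = 1 :> C by case: dP => ->; rewrite ?sqrrN expr1n.
have ab : a = b.
  have := congr1 (fun z => z ^+ 2) eq; rewrite !exprMn ee dd !mul1r !expr2 -!xi_powD //.
  move/(xi_pow_inj p_prime p_odd) => ab; apply: (mulfI (Fp_two_neq0 p_prime p_odd)).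
  by rewrite !mulr_natl !mulr2n.
split=> //; move: eq; rewrite ab => /(mulIf (xi_pow_neq0 R p_prime b)) /eqP.
by rewrite eqr_int => /eqP.
Qed.

Lemma walsh_sign_pm1 f al : walsh_sign R f al = 1 \/ walsh_sign R f al = -1.
Proof. by rewrite /walsh_sign; case: ifP; [left | right]. Qed.

Lemma bent_walshE f al : bent R f ->
  walsh R f al = (walsh_sign R f al)%:~R * (G * chi (bent_dual R f al)).
Proof.
move=> bf; have W : walsh R f al = G * chi (bent_dual R f al) \/
                    walsh R f al = - (G * chi (bent_dual R f al)).
  (* The default value of [bent_dual] is excluded, since [bent_walsh] provides an exponent. *)
  rewrite /bent_dual; case: pickP => [j /orP[] /eqP ->|no]; [by left | by right |].
  have [j Wj] := bent_walsh p_prime p_odd n_odd al bf; have := no j.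
  by case: Wj => ->; rewrite eqxx ?orbT.
rewrite /walsh_sign inE; case: eqP => [-> |nW]; first by rewrite mul1r.
by case: W => // ->; rewrite mulN1r.
Qed.

Lemma BminusE f : bent R f -> Bminus R f = ~: Bplus R f.
Proof.
move=> bf; apply/setP => al; rewrite !inE (bent_walshE al bf).
have := mulf_neq0 (mu_root_pn_neq0 R p_prime p_odd n_odd) (xi_pow_neq0 R p_prime (bent_dual R f al)).
move: (G * _) => z z0; case: (walsh_sign_pm1 f al) => ->; rewrite ?mul1r ?mulN1r ?eqxx.
  by rewrite eq_sym eqNr (negPf z0).
by rewrite eqNr (negPf z0).
Qed.

(** Fourier inversion for xi^f, divided by G: p^n is G times its conjugate, and that conjugate is q
    G. *)
Lemma walsh_sign_inversion f x : bent R f ->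
  \sum_al (walsh_sign R f al)%:~R * chi (bent_dual R f al + dot al x) = q%:~R * (G * chi (f x)).
Proof.
move=> bf; apply: (mulfI (mu_root_pn_neq0 R p_prime p_odd n_odd)).
transitivity ((p ^ n)%:R * chi (f x)); last first.
  by rewrite -(mu_root_pn_norm R p_prime p_odd n_odd) conj_mu_root_pn // !mulrA.
rewrite -(fourier_inversion p_prime p_odd (fun x => chi (f x)) x) mulr_sumr.
apply: eq_bigr => al _; rewrite xi_powD // !mulrA; congr (_ * _).
rewrite [X in X * _]mulrC -[LHS]mulrA -bent_walshE //.
by rewrite /walsh /fourier; apply: eq_bigr => y _; rewrite xi_powD.
Qed.

(** Conjugation by a^h costs no sign because h is even, and a^h (f(y) - al.y) = f(ay) - (a^(h-1)
    al).(ay) recognizes the result as a Walsh coefficient of f. *)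
Lemma bent_dual_homog f h : bent R f -> ~~ odd h -> (0 < h)%N ->
  (forall a x, a != 0 -> f (a *: x) = a ^+ h * f x) ->
  forall a al, a != 0 -> bent_dual R f (a ^+ h.-1 *: al) = a ^+ h * bent_dual R f al.
Proof.
move=> bf h_even h0 fh a al a0.
have ah : a ^+ h != 0 by rewrite expf_neq0.
have W x : walsh R f x = \sum_y (1 : int)%:~R * chi (f y - dot x y).
  by apply: eq_bigr => y _; rewrite mul1r.
have := bent_walshE al bf; rewrite W => /(mu_root_pn_scale p_prime p_odd n_odd ah).
rewrite qcharX_even // mulr1.
have -> : \sum_y (1 : int)%:~R * chi (a ^+ h * (f y - dot al y)) = walsh R f (a ^+ h.-1 *: al).
  rewrite W [RHS](reindex_inj (scalerI a0)) /=; apply: eq_bigr => y _.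
  by rewrite fh // dotZl dotZr mulrA -exprSr prednK // mulrBr.
rewrite bent_walshE // => /walsh_value_inj[] //; exact: walsh_sign_pm1.
Qed.

(** Adding the Walsh sum of g to the signed inversion sum kills the terms outside B_+(f) and doubles
    the others. So two values of the form G xi^j, up to sign, have a sum divisible by 2, and
    [mu_root_pn_parity] equates their exponents. *)
Lemma bent_dual_invol f : bent R f -> bent R (bent_dual R f) -> (forall x, f (- x) = f x) ->
  forall x, bent_dual R (bent_dual R f) x = f x.
Proof.
move=> bf bfs fN x; set g := bent_dual R f in bfs *.
rewrite -[RHS]fN.
have rel : 2 * (\sum_(al in Bplus R f) (1 : int)%:~R * chi (g al - dot x al))
  = (walsh_sign R g x)%:~R * (G * chi (bent_dual R g x)) + q%:~R * (G * chi (f (- x))).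
  rewrite -bent_walshE // -walsh_sign_inversion // -big_split /= mulr_sumr.
  rewrite big_mkcond; apply: eq_bigr => al _.
  rewrite dotNr [dot al x]dotC /walsh_sign.
  by case: ifP => _; rewrite ?mul1r ?mulN1r ?subrr // mulr_natl mulr2n.
have := mu_root_pn_parity p_prime p_odd n_odd (walsh_sign_pm1 g x) _ rel.
by apply; exact: q_pm1.
Qed.

Lemma double_sum_sign (S : {set V}) (F : V -> C) (s : V -> int) :
  (forall x, s x = if x \in S then -1 else 1) ->
  2 * (\sum_(x in S) F x) = \sum_x F x - \sum_x (s x)%:~R * F x
  /\ 2 * (\sum_(x in ~: S) F x) = \sum_x F x + \sum_x (s x)%:~R * F x.
Proof.
move=> sS; rewrite -sumrB -big_split /= !mulr_sumr.
rewrite big_mkcond [\sum_(i in ~: S) _]big_mkcond; split; apply: eq_bigr => x _;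
  rewrite ?in_setC sS; case: (x \in S);
  by rewrite ?mul1r ?mulN1r ?opprK ?subrr //= mulr_natl mulr2n.
Qed.

(** * Exponential sums over the sign sets *)

Section DualIdentities.
Variable f : V -> 'F_p.
Local Notation g := (bent_dual R f).
Hypotheses (bf : bent R f) (bg : bent R g).
Hypotheses (fN : forall x, f (- x) = f x) (gN : forall al, g (- al) = g al).
Local Notation D := (Bminus R g).
Local Notation E := [set al | walsh_sign R f al == - q].

Lemma walsh_sign_dual x : walsh_sign R g x = if x \in D then -1 else 1.
Proof. by rewrite BminusE // in_setC /walsh_sign; case: (x \in _). Qed.

Lemma two_inj : injective (fun z : C => 2 * z).
Proof. by apply: mulfI; rewrite pnatr_eq0. Qed.

Lemma signed_sum_dual al :
  \sum_x (walsh_sign R g x)%:~R * chi (f x - dot al x) = q%:~R * (G * chi (g al)).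
Proof.
rewrite -gN -walsh_sign_inversion //; apply: eq_bigr => x _.
by rewrite bent_dual_invol // dotNr dotC.
Qed.

Lemma walsh_sign_q al : al \notin E -> walsh_sign R f al = q.
Proof.
by rewrite inE; case: (walsh_sign_pm1 f al) => ->; case: (q_pm1 p) => ->.
Qed.

(** Twice the sum is the Walsh coefficient of f minus its version signed by g, that is (e - q) G
    xi^(g(al)) with e the sign of f at al; this is 0 for e = q and doubles - q for e = - q. *)
Lemma sum_dual_minus al : \sum_(x in D) chi (f x - dot al x)
  = (if al \in E then - q else 0)%:~R * (G * chi (g al)).
Proof.
apply: two_inj; have [-> _] := double_sum_sign (fun x => chi (f x - dot al x)) walsh_sign_dual.
rewrite -/(walsh R f al) bent_walshE // signed_sum_dual.
case: (boolP (al \in E)) => [|/walsh_sign_q ->]; last by rewrite subrr mul0r mulr0.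
by rewrite inE => /eqP ->; rewrite rmorphN !mulNr mulrN mulr_natl mulr2n opprD.
Qed.

Lemma sum_dual_plus al : \sum_(x in ~: D) chi (f x - dot al x)
  = (if al \in E then 0 else q)%:~R * (G * chi (g al)).
Proof.
apply: two_inj; have [_ ->] := double_sum_sign (fun x => chi (f x - dot al x)) walsh_sign_dual.
rewrite -/(walsh R f al) bent_walshE // signed_sum_dual.
case: (boolP (al \in E)) => [|/walsh_sign_q ->]; last by rewrite mulr_natl mulr2n.
by rewrite inE => /eqP ->; rewrite rmorphN mulNr addNr mul0r mulr0.
Qed.

(** The product of q and the sign of f is -1 exactly on E, so twice the sum is the Walsh coefficient
    of g at x minus G xi^(f(x)). *)
Lemma sum_dual_support x : \sum_(al in E) chi (g al - dot x al)
  = (if x \in D then -1 else 0)%:~R * (G * chi (f x)).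
Proof.
have sE al : q * walsh_sign R f al = if al \in E then -1 else 1.
  rewrite inE; case: (walsh_sign_pm1 f al) => ->; by case: (q_pm1 p) => ->.
apply: two_inj; have [-> _] := double_sum_sign (fun al => chi (g al - dot x al)) sE.
have -> : \sum_al (q * walsh_sign R f al)%:~R * chi (g al - dot x al) = G * chi (f x).
  transitivity (q%:~R * (q%:~R * (G * chi (f (- x))))).
    rewrite -walsh_sign_inversion // mulr_sumr; apply: eq_bigr => al _.
    by rewrite dotNr dotC rmorphM mulrA.
  by rewrite mulrA -rmorphM /= qchar_norm ?oppr_eq0 ?oner_eq0 // mul1r fN.
rewrite -/(walsh R g x) bent_walshE // bent_dual_invol // walsh_sign_dual.
move: (G * _) => z; case: ifP => _; last by rewrite mul1r subrr mul0r mulr0.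
by rewrite mulN1r mulrN mulr_natl mulr2n opprD.
Qed.

End DualIdentities.
End BentDual.

(** Bezout gives k with (h - 1) k = 1 modulo p - 1; as p - 1 is even, both h - 1 and k are odd. *)
Lemma Fp_exp_inverse (p h : nat) : prime p -> odd p -> (0 < h)%N -> gcdn h.-1 p.-1 = 1%N ->
  [/\ ~~ odd h & exists2 k, odd k & forall a : 'F_p, a != 0 -> a ^+ (h.-1 * k) = a].
Proof.
move=> p_prime p_odd h0 gh.
have p1_even : ~~ odd p.-1 by move: p_odd; rewrite -{1}(prednK (prime_gt0 p_prime)).
have h1_odd : odd h.-1.
  apply: contraT => h1; have : (2 %| gcdn h.-1 p.-1)%N by rewrite dvdn_gcd !dvdn2 h1.
  by rewrite gh.
have h_even : ~~ odd h by move: h1_odd; rewrite -{2}(prednK h0) /= negbK.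
split=> //; have h1_gt0 : (0 < h.-1)%N by case: (h.-1) h1_odd.
case: (egcdnP p.-1 h1_gt0) => k l kl _; rewrite gh in kl.
exists k => [|a a0].
  have := congr1 odd kl; rewrite oddD !oddM h1_odd (negPf p1_even) andbF andbT.
  by move=> ->.
by rewrite mulnC kl mulnC exprD exprM Fp_exp_pred // expr1n mul1r.
Qed.

Theorem proposition5 (R : realType) (p n r : nat)
    (f : 'rV['F_p]_n -> 'F_p)
    (p_prime : prime p) (p_odd : odd p)
    (n_ge3 : (3 <= n)%N) (n_odd : odd n)
    (f_nwr : ~ weakly_regular R f) (f_DBF : DBF R f)
    (f_sub : if (p == 1 %[mod 4])%N then
       [/\ is_subspace_of_dim r (Bminus R f), dot_nondegenerate (Bminus R f),
           is_subspace_of_dim r (Bminus R (bent_dual R f)) &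
           dot_nondegenerate (Bminus R (bent_dual R f))]
     else
       [/\ is_subspace_of_dim r (Bplus R f), dot_nondegenerate (Bplus R f),
           is_subspace_of_dim r (Bminus R (bent_dual R f)) &
           dot_nondegenerate (Bminus R (bent_dual R f))]) :
  let c := cset R f in
  let d := dset R f in
  [/\ r = n.+1./2 -> (p = 1 %[mod 4])%N ->
      @induces_symmetric_scheme p n 5
        [tuple [set 0]; c 0; \bigcup_(i in SQ p) c i; \bigcup_(i in NSQ p) c i;
               d 0 :\ 0; \bigcup_(i in NSQ p) d i],
      r = n.+1./2 -> (p = 3 %[mod 4])%N ->
      @induces_symmetric_scheme p n 5
        [tuple [set 0]; c 0; \bigcup_(i in SQ p) c i; \bigcup_(i in NSQ p) c i;
               d 0 :\ 0; \bigcup_(i in SQ p) d i],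
      (n.+1./2 < r <= n.-1)%N -> (p = 1 %[mod 4])%N ->
      @induces_symmetric_scheme p n 7
        [tuple [set 0]; c 0; \bigcup_(i in SQ p) c i; \bigcup_(i in NSQ p) c i;
               dot_perp (Bminus R f) :\ 0; d 0 :\: dot_perp (Bminus R f);
               \bigcup_(i in SQ p) d i; \bigcup_(i in NSQ p) d i] &
      (n.+1./2 < r <= n.-1)%N -> (p = 3 %[mod 4])%N ->
      @induces_symmetric_scheme p n 7
        [tuple [set 0]; c 0; \bigcup_(i in SQ p) c i; \bigcup_(i in NSQ p) c i;
               dot_perp (Bplus R f) :\ 0; d 0 :\: dot_perp (Bplus R f);
               \bigcup_(i in SQ p) d i; \bigcup_(i in NSQ p) d i]].
Proof.
move=> c d.
case: f_DBF => -[bf bg] f0 [h [h_gt0 h_gcd f_homog]].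
have [h_even [k k_odd hk]] := Fp_exp_inverse p_prime p_odd h_gt0 h_gcd.
(* [bent_dual_homog] is applied to a^k: its power h - 1 is a, and its power h is a^(k+1). *)
have g_homog a al : a != 0 -> bent_dual R f (a *: al) = a ^+ k.+1 * bent_dual R f al.
  move=> a0; have := bent_dual_homog p_prime p_odd n_odd bf h_even h_gt0 f_homog al (expf_neq0 k a0).
  rewrite -exprM mulnC hk // => ->; congr (_ * _).
  by rewrite -exprM -(prednK h_gt0) mulnS exprD mulnC hk // exprSr.
have N1 : -1 != 0 :> 'F_p by rewrite oppr_eq0 oner_eq0.
have fN x : f (- x) = f x.
  by rewrite -scaleN1r f_homog // -signr_odd (negPf h_even) mul1r.
have gN al : bent_dual R f (- al) = bent_dual R f al.
  by rewrite -scaleN1r g_homog // -signr_odd /= k_odd mul1r.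
set g := bent_dual R f in bg g_homog gN f_sub.
set D := Bminus R g; set E := [set al | walsh_sign R f al == - qchar (-1 : 'F_p)].
have sumD := sum_dual_minus p_prime p_odd n_odd bf bg fN gN.
have sumC := sum_dual_plus p_prime p_odd n_odd bf bg fN gN.
have sumE := sum_dual_support p_prime p_odd n_odd bf bg fN.
(* The character of -1 is (-1)^((p-1)/2), which is 1 exactly when p = 1 modulo 4. *)
have EB : E = if (p == 1 %[mod 4])%N then Bminus R f else Bplus R f.
  apply/setP => al; rewrite (prime_mod4 p_prime p_odd) inE qcharN1 // -signr_odd.
  by case: odd => /=; rewrite ?BminusE // ?in_setC /walsh_sign; case: (al \in _).
have [dimE dimD] : is_subspace_of_dim r E /\ is_subspace_of_dim r D.
  by rewrite EB; case: ifP f_sub => _ [].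
have CE : ~: D = Bplus R g by rewrite /D BminusE // setCK.
have c0 : c 0 = [set x in ~: D | qchar (f x) == 0].
  by rewrite CE; apply/setP => x; rewrite !inE qchar_eq0.
have d0 : d 0 = [set x in D | qchar (f x) == 0].
  by apply/setP => x; rewrite !inE qchar_eq0.
have cS (S : {set 'F_p}) s : (forall j, (j \in S) = (qchar j == s)) ->
    \bigcup_(i in S) c i = [set x in ~: D | qchar (f x) == s].
  move=> Ss; rewrite CE; apply/setP => x; rewrite in_set -Ss; apply/bigcupP/andP.
    by case=> i iS; rewrite in_set => /andP[xB /eqP ->].
  by case=> xB fS; exists (f x); rewrite // in_set xB eqxx.
have dS (S : {set 'F_p}) s : (forall j, (j \in S) = (qchar j == s)) ->
    \bigcup_(i in S) d i = [set x in D | qchar (f x) == s].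
  move=> Ss; apply/setP => x; rewrite in_set -Ss; apply/bigcupP/andP.
    by case=> i iS; rewrite in_set => /andP[xB /eqP ->].
  by case=> xB fS; exists (f x); rewrite // in_set xB eqxx.
have mSQ := mem_SQ p_prime p_odd; have mNSQ := mem_NSQ p_prime p_odd.
rewrite c0 d0 (cS _ _ mSQ) (cS _ _ mNSQ) (dS _ _ mSQ) (dS _ _ mNSQ).
have rE : (n.+1./2 = n./2.+1)%N by rewrite /= uphalf_half n_odd.
have q1 : (p = 1 %[mod 4])%N -> qchar (-1 : 'F_p) = 1 /\ E = Bminus R f.
  move=> p4; rewrite EB p4 eqxx; split=> //; move/eqP: p4; rewrite prime_mod4 // => m_even.
  by rewrite qcharN1 // -signr_odd (negPf m_even).
have q3 : (p = 3 %[mod 4])%N -> qchar (-1 : 'F_p) = -1 /\ E = Bplus R f.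
  move=> p4; have p41 : (p == 1 %[mod 4])%N = false by rewrite p4.
  rewrite EB p41; split=> //; move: p41; rewrite prime_mod4 // => /negbFE m_odd.
  by rewrite qcharN1 // -signr_odd m_odd.
have s5 := scheme5 p_prime p_odd n_odd f_homog g_homog hk h_even k_odd f0 sumD sumC dimD dimE.
have s7 := scheme7 p_prime p_odd n_odd f_homog g_homog hk h_even k_odd f0 sumD sumC sumE dimD dimE.
have rn : (n.+1./2 < r <= n.-1)%N -> (n./2.+1 < r < n)%N.
  by rewrite rE => /andP[-> rn] /=; rewrite -(prednK (ltnW (ltnW n_ge3))) ltnS.
split=> [rr /q1[qE _]|rr /q3[qE _]|/rn rr /q1[_ <-]|/rn rr /q3[_ <-]].
- by move: (s5 (etrans rr rE) n_ge3); rewrite qE.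
- by move: (s5 (etrans rr rE) n_ge3); rewrite qE opprK.
- exact: s7 rr.
- exact: s7 rr.
Qed.
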